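(* Let $0\leq s<1$, let $p\geq 1$ be an integer, and let $(a_n)_{n=0}^{\infty}$ be a greedy $s$-energy sequence on the unit circle $S^1$ with initial set of distinct points $(a_0,\ldots,a_p)$. Then $$\lim_{N\to\infty}\frac{E_s(\alpha_{N,s})}{N^2}=\lim_{N\to\infty}\frac{U_{N,s}(a_N)}{N}=I_s(\sigma),$$ where $I_0(\sigma)=0$. The sequence $(a_n)_{n=0}^{\infty}$ is uniformly distributed, i.e. $$\frac{1}{N}\sum_{k=0}^{N-1}\delta_{a_k}\longrightarrow\sigma,\qquad N\to\infty,$$ in the weak-star topology.
   Context: $S^1=\{z\in\mathbb{C}:|z|=1\}$. The kernel is $k_0(z,w)=\log\frac{1}{|z-w|}$ and $k_s(z,w)=|z-w|^{-s}$ for $s>0$ (equal to $+\infty$ when $z=w$). Given $p\geq 1$ and $p+1$ distinct points $a_0,\ldots,a_p\in S^1$, a sequence $(a_n)_{n=0}^{\infty}\subset S^1$ extending these points is a greedy $s$-energy sequence on $S^1$ with initial set $(a_0,\ldots,a_p)$ if $$\sum_{k=0}^{n-1}k_s(a_n,a_k)=\inf_{z\in S^1}\sum_{k=0}^{n-1}k_s(z,a_k)\qquad\text{for all } n\geq p+1.$$ Notation: $\alpha_{N,s}=(a_0,\ldots,a_{N-1})$, $U_{N,s}(z)=\sum_{k=0}^{N-1}k_s(z,a_k)$, $E_s(\alpha_{N,s})=\sum_{0\leq i\neq j\leq N-1}k_s(a_i,a_j)$. $\sigma$ is the normalized arc-length (probability) measure on $S^1$, and $I_s(\sigma)=\iint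 k_s(x,y)\,d\sigma(x)\,d\sigma(y)$. $\delta_a$ is the unit point mass at $a$. *)

(* Defs.v *)
From HB Require Import structures.
From mathcomp Require Import all_boot all_order all_algebra.
From mathcomp Require Import complex lra.
From mathcomp Require Import all_classical all_reals all_analysis.

Set Implicit Arguments.
Unset Strict Implicit.
Unset Printing Implicit Defensive.

Import Order.TTheory GRing.Theory Num.Theory.
Import numFieldNormedType.Exports.
Import ComplexField.

Local Open Scope classical_set_scope.
Local Open Scope complex_scope.
Local Open Scope ring_scope.

(* The topology on the complex numbers is that of R[i]^o, i.e. the one induced
   by the modulus; the norm of R[i] takes its values in R[i], whereas
   [Normc.normc] is the same modulus with values in R. *)
Definition Borel_complex (R : realType) := g_sigma_algebraType (@open R[i]^o).

Definition unit_circle (R : realType) : set R[i]^o :=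
  [set z | Normc.normc z = 1].

(* The value +oo on the diagonal is explicit because ln and powR take finite
   conventional values at 0. *)
Definition riesz_kernel (R : realType) (s : R) (z w : R[i]) : \bar R :=
  if z == w then +oo%E
  else if s == 0 then (ln (1 / Normc.normc (z - w)))%:E
  else (Normc.normc (z - w) `^ (- s))%:E.

Definition potential (R : realType) (s : R) (a : nat -> R[i]) (N : nat)
    (z : R[i]) : \bar R :=
  (\sum_(k < N) riesz_kernel s z (a k))%E.

Definition discrete_energy (R : realType) (s : R) (a : nat -> R[i]) (N : nat) :
    \bar R :=
  (\sum_(i < N) \sum_(j < N | i != j) riesz_kernel s (a i) (a j))%E.

Definition greedy_energy_sequence (R : realType) (s : R) (p : nat)
    (a : nat -> R[i]) : Prop :=
  [/\ forall n, unit_circle (a n),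
      forall i j, (i <= p)%N -> (j <= p)%N -> a i = a j -> i = j
    & forall n, (p.+1 <= n)%N ->
        potential s a n (a n)
        = ereal_inf [set potential s a n z | z in @unit_circle R]].

Definition expi (R : realType) (t : measurableTypeR R) : Borel_complex R :=
  cos (t : R) +i* sin (t : R).

Lemma normc_lt_ReIm (R : realType) (z : R[i]) (e : R) : 0 < e ->
  `|complex.Re z| < e / 2 -> `|complex.Im z| < e / 2 -> Normc.normc z < e.
Proof.
move=> e0; case: z => x y /= xe ye.
rewrite -[ltRHS]ger0_norm ?ltW// -sqrtr_sqr ltr_sqrt ?exprn_gt0//.
rewrite -(real_normK (num_real x)) -(real_normK (num_real y)).
apply: (@lt_le_trans _ _ ((e / 2) ^+ 2 + (e / 2) ^+ 2)).
  by rewrite ltrD// ltrXn2r// ?divr_ge0 ?ltW.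
by have := sqr_ge0 e; lra.
Qed.

Lemma continuous_expi (R : realType) :
  continuous ((fun t => cos t +i* sin t) : R -> R[i]^o).
Proof.
move=> t; apply/cvgrPdist_lt => -[e ime].
rewrite ltcE /= => /andP[/eqP -> e0].
have e2 : 0 < e / 2 by rewrite divr_gt0.
have /cvgrPdist_lt/(_ _ e2) hc := @continuous_cos R t.
have /cvgrPdist_lt/(_ _ e2) hs := @continuous_sin R t.
near=> u.
suff : Normc.normc ((cos t +i* sin t) - (cos u +i* sin u)) < e.
  by rewrite -ltcR.
by apply: normc_lt_ReIm => //=; near: u; [exact: hc|exact: hs].
Unshelve. all: by end_near. Qed.

Lemma measurable_expi (R : realType) :
  measurable_fun [set: measurableTypeR R] (@expi R).
Proof.
apply: (@measurability _ _ _ (Borel_complex R) _ _ (@open R[i]^o) erefl).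
move=> _ [B oB <-]; rewrite setTI; apply: measurable_realfun.open_measurable.
by apply: open_comp => // t _; exact: continuous_expi.
Qed.

HB.instance Definition _ (R : realType) :=
  isMeasurableFun.Build _ _ _ _ (@expi R) (@measurable_expi R).

Lemma lt0_2pi (R : realType) : 0 < 2 * pi :> R.
Proof. by rewrite mulr_gt0 ?pi_gt0. Qed.

(* Normalized arc length on the unit circle, as a Borel probability measure on
   the complex plane: the law of exp(i t) for t uniform on [0, 2 pi]. *)
Definition arc_measure (R : realType) : probability (Borel_complex R) R :=
  @distribution _ _ _ (Borel_complex R) R (uniform_prob (lt0_2pi R)) (@expi R).

Definition arc_energy (R : realType) (s : R) : \bar R :=
  (\int[@arc_measure R]_(x in @unit_circle R)
     \int[@arc_measure R]_(y in @unit_circle R) riesz_kernel s x y)%E.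

(* For N = 0 this is the null measure. *)
Definition empirical_measure (R : realType) (a : nat -> R[i]) (N : nat) :
    {measure set (Borel_complex R) -> \bar R} :=
  mscale (N%:R^-1)%:nng (msum (fun k => \d_(a k : Borel_complex R)) N).

Definition weak_star_cvg (R : realType)
    (mu_ : nat -> {measure set (Borel_complex R) -> \bar R})
    (mu : {measure set (Borel_complex R) -> \bar R}) : Prop :=
  forall f : R[i]^o -> R, {within @unit_circle R, continuous f} ->
    (fun N => \int[mu_ N]_(x in @unit_circle R) (f x)%:E)%E @ \oo -->
    (\int[mu]_(x in @unit_circle R) (f x)%:E)%E.

(* Main.v *)
Require Import Defs.
From mathcomp Require Import all_boot all_order all_algebra.
From mathcomp Require Import complex ring lra zify.
From mathcomp Require Import all_classical all_reals all_analysis.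
From mathcomp Require Import measurable_realfun.

(** Why the theorem holds. On the circle the kernel is a function phi(<z, w>)
    of the inner product <z, w> = Re z Re w + Im z Im w, namely
    (2 - 2x)^(-s/2), or - ln (2 - 2x) / 2 when s = 0. Its Taylor series at 0
    has positive coefficients after the constant one, and every truncation of
    even length stays below phi on [-1, 1[ ([taylor_le_riesz_profile]).
    Each power <z, w>^n is a positive semidefinite kernel. If M_n is its mean
    over the circle, the discrepancy
      D_n(N) = N^-2 sum_(i, j < N) <a_i, a_j>^n - M_n
    is a squared norm, hence nonnegative, and by Cauchy-Schwarz it dominates
    the square of N^-1 sum_(k < N) <z, a_k>^n - M_n for every z on the circle
    ([sqr_power_average_le]).

    Let I be the limit of the means J_m of the truncations. Arc length has
    constant potential I, so the greedy minimum U_n(a_n) is at most n I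
    ([greedy_potential_le]), and summation bounds the energy by N^2 I + O(N).
    Bounding phi from below by a truncation with coefficients b_n bounds the
    energy from below by N^2 (J_m + sum_n b_n D_n(N)) - O(N)
    ([real_energy_ge]). Comparing the two, the energy divided by N^2 tends to
    I and every D_n(N) tends to 0. Averages of polynomials in <z, a_k> then
    converge uniformly in z ([poly_average_unif_cvg]); applied to a truncation
    at z = a_N this bounds U_N(a_N) / N from below ([next_potential_cvg]),
    and applied to the peaked kernels ((1 + <z, w>) / 2)^n it yields uniform
    distribution by a Korovkin argument ([uniform_distribution]).

    There remains to identify I with the energy integral of arc length. Since
    the truncations increase to phi, monotone convergence does it
    ([riesz_emean_cvg]), and only the moments M_n of a circular motion matter.
    That I is finite comes from doubling the angle: |1 - z^2| is at most
    2 |1 - z| and 2 |1 + z|, while z^2 and z have the same law, which gives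
    I >= 2^(1-s) I - O(1) ([riesz_doubling], [taylor_mean_bounded]). For
    s = 0 the identity |1 - z^2| = |1 - z| |1 + z| gives I = 2 I, so I = 0
    ([riesz_energy0]). *)

Set Implicit Arguments.
Unset Strict Implicit.
Unset Printing Implicit Defensive.

Import Order.TTheory GRing.Theory Num.Theory.
Import numFieldNormedType.Exports.

Local Open Scope classical_set_scope.
Local Open Scope complex_scope.
Local Open Scope ring_scope.

(** * Continuity and derivatives of pointwise combinations *)

Section pointwise.
Context {R : realType}.
Implicit Types f g : R -> R.

Lemma continuous_funD f g : continuous f -> continuous g ->
  continuous (fun t => f t + g t).
Proof. by move=> cf cg t; apply: cvgD; [exact: cf|exact: cg]. Qed.

Lemma continuous_funM f g : continuous f -> continuous g ->
  continuous (fun t => f t * g t).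
Proof. by move=> cf cg t; apply: cvgM; [exact: cf|exact: cg]. Qed.

Lemma continuous_funZ (c : R) f : continuous f -> continuous (fun t => c * f t).
Proof. by move=> cf; apply: continuous_funM => //; exact: cst_continuous. Qed.

Lemma continuous_funX f n : continuous f -> continuous (fun t => f t ^+ n).
Proof.
move=> cf t; apply: (@continuous_comp _ _ _ f (fun x => x ^+ n)); first exact: cf.
exact: exprn_continuous.
Qed.

Lemma continuous_fun_sum n (F : nat -> R -> R) : (forall i, continuous (F i)) ->
  continuous (fun t => \sum_(i < n) F i t).
Proof.
by move=> cF; apply: continuous_big => [|i _]; [exact: add_continuous|exact: cF].
Qed.

Lemma continuous_is_derive (f f' : R -> R) :
  (forall t, is_derive (t : R) (1 : R) f (f' t)) -> continuous f.
Proof.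
by move=> df t; apply/differentiable_continuous/derivable1_diffP; case: (df t).
Qed.

Lemma is_derive_funD (f g : R -> R) (x df dg : R) :
  is_derive (x : R) (1 : R) f df -> is_derive (x : R) (1 : R) g dg ->
  is_derive (x : R) (1 : R) (fun t => f t + g t) (df + dg).
Proof. exact: is_deriveD. Qed.

Lemma is_derive_funM (f g : R -> R) (x df dg : R) :
  is_derive (x : R) (1 : R) f df -> is_derive (x : R) (1 : R) g dg ->
  is_derive (x : R) (1 : R) (fun t => f t * g t) (f x * dg + g x * df).
Proof. exact: is_deriveM. Qed.

Lemma is_derive_funZ (c : R) (f : R -> R) (x df : R) :
  is_derive (x : R) (1 : R) f df -> is_derive (x : R) (1 : R) (fun t =>
    c * f t) (c * df).
Proof. exact: is_deriveZ. Qed.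

Lemma is_derive_funX (f : R -> R) n (x df : R) :
  is_derive (x : R) (1 : R) f df -> is_derive (x : R) (1 : R) (fun t =>
    f t ^+ n.+1) (n.+1%:R * f x ^+ n * df).
Proof.
move=> h; rewrite (_ : (fun t => _) = f ^+ n.+1); first exact: is_deriveX.
by apply/funext => t; rewrite fctE.
Qed.

Lemma near_div_natr_lt (K e : R) : 0 < e -> \forall N \near \oo, K / N%:R < e.
Proof.
move=> e0; near=> N.
have N0 : (0 < N)%N by near: N; exists 1%N.
rewrite ltr_pdivrMr ?ltr0n// mulrC -ltr_pdivrMr//.
by near: N; exact: nbhs_infty_gtr.
Unshelve. all: by end_near. Qed.

End pointwise.

(** * Mean values over the circle *)

Section circle_mean.
Context {R : realType}.
Implicit Types (f g : R -> R).

Definition circle_mean g : R :=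
  (2 * pi)^-1 * \int[lebesgue_measure]_(t in `[0, 2 * pi]) g t.

Local Notation mu := (@lebesgue_measure R).

Lemma continuous_integrable02pi g : continuous g ->
  mu.-integrable `[0, 2 * pi] (EFin \o g).
Proof.
move=> cg; apply: continuous_compact_integrable; first exact: segment_compact.
exact: continuous_subspaceT.
Qed.

Lemma eq_circle_mean f g : f =1 g -> circle_mean f = circle_mean g.
Proof. by move=> /funext ->. Qed.

Lemma circle_meanD f g : continuous f -> continuous g ->
  circle_mean (fun t => f t + g t) = circle_mean f + circle_mean g.
Proof.
move=> cf cg; rewrite /circle_mean -mulrDr; congr (_ * _).
by rewrite RintegralD//; exact: continuous_integrable02pi.
Qed.

Lemma circle_meanZ c g : continuous g ->
  circle_mean (fun t => c * g t) = c * circle_mean g.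
Proof.
move=> cg; rewrite /circle_mean mulrCA; congr (_ * _).
by rewrite RintegralZl//; exact: continuous_integrable02pi.
Qed.

Lemma circle_mean_cst (c : R) : circle_mean (fun=> c) = c.
Proof.
rewrite /circle_mean Rintegral_cst//.
have := @lebesgue_measure_itv R `[0, 2 * pi]; rewrite /= lte_fin (lt0_2pi R).
move=> ->; have := lt0_2pi R; move: (2 * pi) => w w0.
by rewrite -EFinB/= subr0 mulrCA mulVf ?mulr1// gt_eqF.
Qed.

Lemma le_circle_mean f g : continuous f -> continuous g ->
  (forall t, f t <= g t) -> circle_mean f <= circle_mean g.
Proof.
move=> cf cg fg; rewrite /circle_mean ler_pM2l ?invr_gt0 ?lt0_2pi//.
apply: le_Rintegral => //; exact: continuous_integrable02pi.
Qed.

Lemma circle_mean_sum n (F : nat -> R -> R) : (forall i, continuous (F i)) ->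
  circle_mean (fun t => \sum_(i < n) F i t) = \sum_(i < n) circle_mean (F i).
Proof.
move=> cF; elim: n => [|n ih].
  by rewrite big_ord0 -[RHS]circle_mean_cst; apply: eq_circle_mean => t;
    rewrite big_ord0.
rewrite [RHS]big_ord_recr/= -ih -circle_meanD//=.
  by apply: eq_circle_mean => t; rewrite big_ord_recr.
exact: continuous_fun_sum.
Qed.

(** All the moments below are computed from this: exhibiting a periodic
    primitive costs less than a change of variable. *)
Lemma circle_mean_derive (F f : R -> R) : continuous f ->
  (forall t, is_derive (t : R) (1 : R) F (f t)) -> F (2 * pi) = F 0 ->
    circle_mean f = 0.
Proof.
move=> cf dF F02; rewrite /circle_mean /Rintegral (@continuous_FTC2 _ _ F)//.
- by rewrite -EFinB F02 subrr/= mulr0.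
- exact: lt0_2pi.
- exact: continuous_subspaceT.
- have cF : continuous F.
    by move=> t; apply/differentiable_continuous/derivable1_diffP; case: (dF t).
  split.
  + by move=> t _; case: (dF t).
  + exact/cvg_at_right_filter/cF.
  + exact/cvg_at_left_filter/cF.
- by move=> t _; rewrite derive1E; case: (dF t).
Qed.

Lemma circle_mean_abs_le (u v : R -> R) : continuous u -> continuous v ->
  (forall t, `|u t| <= v t) -> `|circle_mean u| <= circle_mean v.
Proof.
move=> cu cv uv; rewrite ler_norml; apply/andP; split; last first.
  by apply: le_circle_mean => // t; exact: le_trans (ler_norm _) (uv t).
rewrite -mulN1r -circle_meanZ//; apply: le_circle_mean => //.
  exact: continuous_funZ.
by move=> t; rewrite mulN1r; have := uv t; rewrite ler_norml => /andP[].
Qed.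

(** Shape of the averaged doubling inequality: when A, B and D have the same
    mean, it bounds that mean as soon as 2 la > 1. *)
Lemma circle_mean_double (A B D : R -> R) (la ka : R) :
  continuous A -> continuous B -> continuous D ->
  (forall t, la * (A t + B t) - ka <= D t) ->
  la * (circle_mean A + circle_mean B) - ka <= circle_mean D.
Proof.
move=> cA cB cD H; have cAB := continuous_funD cA cB.
have cZ := @continuous_funZ R la _ cAB.
have ck : continuous (fun _ : R => - ka) by exact: cst_continuous.
rewrite -circle_meanD// -circle_meanZ// -[- ka]circle_mean_cst -circle_meanD//.
by apply: le_circle_mean => //; exact: continuous_funD.
Qed.

End circle_mean.

(** * Moments of circular motions *)

Section moments.
Context {R : realType}.

(** The moments of the cosine of a uniform angle. *)
Fixpoint moment (n : nat) : R :=
  match n with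
  | 0 => 1
  | 1 => 0
  | n'.+2 => n'.+1%:R / n'.+2%:R * moment n'
  end.

(** Orthogonal coordinates of a point that moves on the unit circle with
    constant angular speed and returns to its start. Every t |-> <z, exp(i t)>
    with |z| = 1 is such a u, and so are - cos t and cos (2 t); a statement
    about all circular motions therefore contains the invariance of arc length
    under rotations and under z |-> z^2. *)
Definition circular_motion (m : R) (u v : R -> R) : Prop :=
  [/\ m != 0, forall t, is_derive (t : R) (1 : R) u (m * v t),
      forall t, is_derive (t : R) (1 : R) v (- m * u t),
      forall t, u t ^+ 2 + v t ^+ 2 = 1
    & u (2 * pi) = u 0 /\ v (2 * pi) = v 0].

Lemma circular_motion_continuous m u v :
  circular_motion m u v -> continuous u /\ continuous v.
Proof. by case=> _ du dv _ _; split; [exact: continuous_is_derive du|exact: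
  continuous_is_derive dv]. Qed.

(** The derivative of v u^(k+1) is m ((k+1) u^k - (k+2) u^(k+2)), and it has
    mean zero. The recursion between moments that results involves neither the
    speed nor the phase. *)
Lemma moment_circular_motion m u v n : circular_motion m u v ->
  circle_mean (fun t => u t ^+ n) = moment n.
Proof.
move=> muv; have [cu cv] := circular_motion_continuous muv.
case: (muv) => m0 du dv uv1 [u2 v2].
have mZ f : continuous f -> circle_mean (fun t => m * f t) = 0 -> circle_mean f = 0.
  by move=> cf; rewrite circle_meanZ// => /eqP; rewrite mulf_eq0 (negbTE m0) => /eqP.
suff H k : circle_mean (fun t => u t ^+ k) = moment k /\
   circle_mean (fun t => u t ^+ k.+1) = moment k.+1 by case: (H n).
elim: k => [|k [IH1 IH2]].
  split; first by rewrite (@eq_circle_mean _ _ (fun=> 1)) ?circle_mean_cst.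
  rewrite (@eq_circle_mean _ _ u)//=.
  apply: mZ => //.
  apply: (@circle_mean_derive _ (fun t => - v t)).
  - exact: continuous_funZ.
  - by move=> t; apply: (is_derive_eq (is_deriveN (dv t))); rewrite mulNr opprK.
  - by rewrite v2.
split=> //.
have key : circle_mean (fun t => (k.+2%:R * u t ^+ k.+2) + (- k.+1%:R * u t ^+ k)) = 0.
  apply: mZ.
    by apply: continuous_funD; apply: continuous_funZ; exact: continuous_funX.
  apply: (@circle_mean_derive _ (fun t => - (v t * u t ^+ k.+1))).
  - apply: continuous_funZ; apply: continuous_funD; apply: continuous_funZ;
      exact: continuous_funX.
  - move=> t.
    apply: (is_derive_eq (is_deriveN (is_derive_funM (dv t) (is_derive_funX k
      (du t))))).
    have -> : u t ^+ k.+2 = u t ^+ 2 * u t ^+ k by rewrite -exprD.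
    have -> : u t ^+ k.+1 = u t * u t ^+ k by rewrite exprS.
    move/eqP: (uv1 t); rewrite eq_sym -subr_eq => /eqP xy.
    transitivity (m * (u t ^+ 2 * u t ^+ k - k.+1%:R * v t ^+ 2 * u t ^+ k));
      first by ring.
    by rewrite -xy -[in k.+2%:R]addn1 natrD; ring.
  - by rewrite u2 v2.
have cX j : continuous (fun t => u t ^+ j) by exact: continuous_funX.
move: key; rewrite circle_meanD ?circle_meanZ ?IH1//=; try exact: continuous_funZ.
move=> key; apply: (@mulfI _ k.+2%:R); first by rewrite pnatr_eq0.
rewrite [RHS]mulrA [_ * (_ / _)]mulrCA mulfV ?pnatr_eq0// mulr1.
by move: key; lra.
Qed.

End moments.

(** * Rotations and doubling as circular motions *)

Section motions.
Context {R : realType}.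

Lemma rotation_motion (x y : R) : x ^+ 2 + y ^+ 2 = 1 ->
  circular_motion 1 (fun t => x * cos t + y * sin t)
                    (fun t => y * cos t - x * sin t).
Proof.
move=> xy; split.
- exact: oner_neq0.
- move=> t; apply: (is_derive_eq (is_derive_funD (is_derive_funZ x (is_derive_cos t))
    (is_derive_funZ y (is_derive_sin t)))); ring.
- move=> t.
  rewrite (_ : (fun t => y * _ - _) = (fun t => y * cos t + (- x) * sin t)); last first.
    by apply/funext => u; ring.
  apply: (is_derive_eq (is_derive_funD (is_derive_funZ y (is_derive_cos t))
    (is_derive_funZ (- x) (is_derive_sin t)))); ring.
- move=> t; transitivity ((x ^+ 2 + y ^+ 2) * (cos t ^+ 2 + sin t ^+ 2)); first by ring.
  by rewrite xy cos2Dsin2 mulr1.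
- by rewrite (mulr_natl pi) cos2pi sin2pi cos0 sin0.
Qed.

Lemma cos_motion : circular_motion 1 (@cos R) (fun t => - sin t).
Proof.
split.
- exact: oner_neq0.
- by move=> t; rewrite mul1r; exact: is_derive_cos.
- by move=> t; rewrite mulN1r; exact: (is_deriveN (is_derive_sin t)).
- by move=> t; rewrite sqrrN cos2Dsin2.
- by rewrite (mulr_natl pi) cos2pi sin2pi cos0 sin0.
Qed.

Lemma double_motion : circular_motion 2 (fun t : R =>
  2 * cos t ^+ 2 - 1) (fun t => - (2 * (cos t * sin t))).
Proof.
split.
- by rewrite pnatr_eq0.
- move=> t; apply: (is_derive_eq (is_deriveB (is_derive_funZ 2 (is_derive_funX 1
  (is_derive_cos t)))
    (is_derive_cst (1:R) (t : R) (1:R)))); ring.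
- move=> t; apply: (is_derive_eq (is_deriveN (is_derive_funZ 2 (is_derive_funM
  (is_derive_cos t) (is_derive_sin t))))).
  by have := cos2Dsin2 t; move: (cos t) (sin t) => x y; lra.
- move=> t; have := cos2Dsin2 t; move: (cos t) (sin t) => x y /eqP.
  by rewrite eq_sym addrC -subr_eq => /eqP xy; rewrite sqrrN !exprMn -xy; ring.
- by rewrite (mulr_natl pi) cos2pi sin2pi cos0 sin0.
Qed.

Lemma opp_motion m (u v : R -> R) : circular_motion m u v ->
  circular_motion m (fun t => - u t) (fun t => - v t).
Proof.
case=> m0 du dv uv [u2 v2]; split => //.
- by move=> t; rewrite mulrN; exact: (is_deriveN (du t)).
- by move=> t; rewrite mulrN; exact: (is_deriveN (dv t)).
- by move=> t; rewrite !sqrrN.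
- by rewrite u2 v2.
Qed.

Lemma circular_motion_norm_le1 m (u v : R -> R) t : circular_motion m u v ->
  `|u t| <= 1.
Proof.
case=> _ _ _ /(_ t) uv _.
rewrite -(@ler_pXn2r _ 2)// ?nnegrE// real_normK ?num_real// expr1n -uv.
by rewrite lerDl sqr_ge0.
Qed.

End motions.

(** * Peaked powers of the cosine *)

Section circle_bump.
Context {R : realType}.

(** The central binomial ratio C(2n, n) / 4^n. *)
Fixpoint bump_mass (n : nat) : R :=
  if n is k.+1 then (k.*2.+1)%:R / (k.*2.+2)%:R * bump_mass k else 1.

Lemma bump_massS n :
  bump_mass n.+1 = (n.*2.+1)%:R / (n.*2.+2)%:R * bump_mass n.
Proof. by []. Qed.

(** At x = <z, w> this is a probability density in w that concentrates at w =
    z, and it is a polynomial in x. *)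
Definition circle_bump (n : nat) (x : R) : R := ((1 + x) / 2) ^+ n / bump_mass n.

Lemma bump_mass_gt0 n : 0 < bump_mass n.
Proof. by elim: n => [|n ih] //=; rewrite mulr_gt0// divr_gt0// ltr0n. Qed.

Lemma circle_bump_ge0 n x : `|x| <= 1 -> 0 <= circle_bump n x.
Proof.
rewrite ler_norml => /andP[x1 _].
by apply: divr_ge0; [apply: exprn_ge0; lra|rewrite ltW ?bump_mass_gt0].
Qed.

Lemma continuous_half_succ (u : R -> R) : continuous u ->
  continuous (fun t => (1 + u t) / 2).
Proof.
by move=> cu t; apply: cvgMl; apply: cvgD; [exact: cvg_cst|exact: cu].
Qed.

Lemma continuous_circle_bump n (u : R -> R) : continuous u ->
  continuous (fun t => circle_bump n (u t)).
Proof.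
move=> cu; apply: continuous_funM; last exact: cst_continuous.
by apply: continuous_funX; exact: continuous_half_succ.
Qed.

(** With w = (1 + u) / 2 one has v^2 = 4 w (1 - w), so the derivative of v
    w^(n+1) is a combination of w^(n+1) and w^(n+2); its mean vanishes. *)
Lemma circle_mean_bump_power m u v n : circular_motion m u v ->
  circle_mean (fun t => ((1 + u t) / 2) ^+ n) = bump_mass n.
Proof.
move=> muv; have [cu cv] := circular_motion_continuous muv.
case: (muv) => m0 du dv uv1 [u2 v2].
pose w t := (1 + u t) / 2.
have dw t : is_derive (t : R) (1 : R) w (m / 2 * v t).
  rewrite (_ : w = (fun t => 2^-1 + 2^-1 * u t)); last first.
    by apply/funext => x; rewrite /w; field.
  by apply: (is_derive_eq (is_derive_funD (is_derive_cst (2^-1:R) (t : R) (1:R))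
    (is_derive_funZ 2^-1 (du t)))); ring.
have cw : continuous w by exact: continuous_is_derive dw.
have cwX j : continuous (fun t => w t ^+ j) by exact: continuous_funX.
have mw1 : circle_mean w = 1 / 2.
  rewrite (@eq_circle_mean _ _ (fun t => 2^-1 + 2^-1 * u t ^+ 1)); last first.
    by move=> x; rewrite /w; field.
  rewrite circle_meanD.
  - by rewrite circle_mean_cst circle_meanZ// (moment_circular_motion _ muv)/=; ring.
  - exact: cst_continuous.
  - by apply: continuous_funZ.
elim: n => [|n ih]; first exact: circle_mean_cst.
case: n ih => [|n] ih; first by rewrite (eq_circle_mean (g := w)) ?mw1//= mulr1.
suff H : m * (n.+2%:R * circle_mean (fun t => w t ^+ n.+2)) =
         m * ((n.+1.*2.+1)%:R / 2 * circle_mean (fun t => w t ^+ n.+1)).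
  move/(mulfI m0): H; rewrite ih => H.
  apply: (@mulfI _ n.+2%:R); first by rewrite pnatr_eq0.
  rewrite H [bump_mass n.+2]bump_massS; move: (bump_mass n.+1) => W.
  have -> : (n.+1.*2.+2)%:R = 2 * n.+2%:R :> R by rewrite -natrM; congr (_%:R); lia.
  by field; rewrite -natr1; have := ler0n R n.+1; lra.
apply/eqP; rewrite -subr_eq0; apply/eqP.
rewrite -!circle_meanZ//; try exact: continuous_funZ.
rewrite -mulN1r -circle_meanZ; last by do 2 apply: continuous_funZ.
rewrite -circle_meanD; try by do ?apply: continuous_funZ.
have cA := @continuous_funZ R m _ (@continuous_funZ R n.+2%:R _ (cwX n.+2)).
have cB := @continuous_funZ R (-1) _ (@continuous_funZ R m _
  (@continuous_funZ R ((n.+1.*2.+1)%:R / 2) _ (cwX n.+1))).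
apply: (@circle_mean_derive _ (fun t => - 2^-1 * (v t * w t ^+ n.+1)) _
  (continuous_funD cA cB)).
- move=> t.
  apply: (is_derive_eq (is_derive_funZ (- 2^-1) (is_derive_funM (dv t)
    (is_derive_funX n (dw t))))).
  have -> : w t ^+ n.+2 = w t ^+ 2 * w t ^+ n by rewrite -exprD.
  have -> : w t ^+ n.+1 = w t * w t ^+ n by rewrite exprS.
  have -> : (n.+1.*2.+1)%:R = 2 * n.+1%:R + 1 :> R by rewrite -natrM natr1;
    congr (_%:R); lia.
  have vE : v t ^+ 2 = 1 - u t ^+ 2 by have := uv1 t; lra.
  move: vE; have -> : u t = 2 * w t - 1 by rewrite /w; field.
  move=> vE.
  transitivity (m / 2 * ((2 * w t - 1) * w t * w t ^+ n - n.+1%:R / 2 * v t ^+ 2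
    * w t ^+ n)); first by field.
  by rewrite vE -[in n.+2%:R]addn1 natrD; field.
- by rewrite v2 /w u2.
Qed.

Lemma circle_mean_bump m u v n : circular_motion m u v ->
  circle_mean (fun t => circle_bump n (u t)) = 1.
Proof.
move=> muv; rewrite -[RHS](@mulVf _ (bump_mass n)) ?gt_eqF ?bump_mass_gt0//.
rewrite -(circle_mean_bump_power n muv) -circle_meanZ.
  by apply: eq_circle_mean => t; rewrite /circle_bump (circle_mean_bump_power n
    muv) mulrC.
have [cu _] := circular_motion_continuous muv.
by apply: continuous_funX; exact: continuous_half_succ.
Qed.

(** Since 1 - u = 2 (1 - (1 + u) / 2), the mean is 2 (1 - W_(n+1) / W_n),
    where W_n is the mass. On the circle 1 - <z, w> = |z - w|^2 / 2, so this
    measures how far the density spreads around z. *)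
Lemma circle_mean_bump_spread m u v n : circular_motion m u v ->
  circle_mean (fun t => (1 - u t) * circle_bump n (u t)) = n.+1%:R^-1.
Proof.
move=> muv; have [cu _] := circular_motion_continuous muv.
have cw := continuous_half_succ cu.
have W0 := bump_mass_gt0 n.
rewrite (@eq_circle_mean _ _ (fun t => 2 / bump_mass n * ((1 + u t) / 2) ^+ n +
    - 2 / bump_mass n * ((1 + u t) / 2) ^+ n.+1)); last first.
  move=> t; rewrite /circle_bump exprS; move: (((1 + u t) / 2) ^+ n) => z.
  by field; rewrite gt_eqF.
rewrite circle_meanD ?circle_meanZ; try by do ?apply: continuous_funZ;
  exact: continuous_funX.
rewrite !(circle_mean_bump_power _ muv) bump_massS -!muln2 -[in n.+1%:R]natr1.
have -> : (n * 2).+1%:R = n%:R * 2 + 1 :> R by rewrite -natrM natr1.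
have -> : (n * 2).+2%:R = n%:R * 2 + 2 :> R by rewrite -natrM -natrD addn2.
have := ler0n R n; move: (n%:R) => x x0.
field; rewrite (gt_eqF W0) andbT.
by apply/andP; split; rewrite gt_eqF//; lra.
Qed.

Lemma momentSS n : moment n.+2 = n.+1%:R / n.+2%:R * moment n :> R.
Proof. by []. Qed.

Lemma moment_double n : moment n.*2.+1 = 0 :> R /\ (moment n.*2 : R) = bump_mass n.
Proof.
elim: n => [|n [ih1 ih2]]; first by [].
by rewrite doubleS !momentSS ih1 mulr0 ih2 bump_massS.
Qed.

Lemma moment_ge0 n : 0 <= moment n :> R.
Proof.
rewrite -(odd_double_half n); have [h1 h2] := moment_double n./2.
by case: (odd n); rewrite ?add0n ?add1n ?h1 ?h2// ltW// bump_mass_gt0.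
Qed.

(** The bound W_n^2 (2n+1) <= 1 is preserved by the recursion because
    (2n+1)(2n+3) <= (2n+2)^2. *)
Lemma bump_mass_cvg0 : bump_mass n @[n --> \oo] --> (0 : R).
Proof.
have bnd n : bump_mass n ^+ 2 * n.*2.+1%:R <= 1 :> R.
  elim: n => [|n ih]; first by rewrite expr1n mulr1.
  apply: le_trans ih; rewrite bump_massS exprMn.
  rewrite -mulrA mulrCA ler_wpM2l ?sqr_ge0//.
  rewrite doubleS -!muln2 exprMn exprVn mulrAC ler_pdivrMr ?exprn_gt0//.
  rewrite -!natrX -!natrM ler_nat; lia.
apply/cvgrPdist_lt => e e0.
have K := near_div_natr_lt 1 (exprn_gt0 2 e0).
near=> n; rewrite sub0r normrN gtr0_norm ?bump_mass_gt0//.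
rewrite -(@ltr_pXn2r _ 2)// ?nnegrE ?(ltW e0) ?(ltW (bump_mass_gt0 n))//.
have n0 : (0 < n)%N by near: n; exists 1%N.
have : 1 / n%:R < e ^+ 2 by near: n.
apply: le_lt_trans; rewrite ler_pdivlMr ?ltr0n//.
apply: le_trans (bnd n); rewrite ler_wpM2l ?sqr_ge0// ler_nat -addnn; lia.
Unshelve. all: by end_near. Qed.

Lemma circle_bump_expand n (x : R) :
  circle_bump n x = \sum_(j < n.+1) ('C(n, j)%:R / 2 ^+ n / bump_mass n) * x ^+ j.
Proof.
rewrite /circle_bump exprMn exprDn !mulr_suml; apply: eq_bigr => j _.
by rewrite expr1n mul1r -[x ^+ j *+ _]mulr_natl exprVn; ring.
Qed.

End circle_bump.

(** * Power discrepancies of finitely many points *)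

Section discrepancy.
Context {R : realType}.
Implicit Types (z w : R[i]) (a : nat -> R[i]).

Definition dot (z w : R[i]) : R :=
  complex.Re z * complex.Re w + complex.Im z * complex.Im w.

Definition circle_pt (t : R) : R[i] := cos t +i* sin t.

Lemma dotC z w : dot z w = dot w z.
Proof. by rewrite /dot; congr (_ + _); rewrite mulrC. Qed.

Lemma unit_circleE z :
  unit_circle z <-> complex.Re z ^+ 2 + complex.Im z ^+ 2 = 1.
Proof.
case: z => x y; rewrite /unit_circle /=; split => h.
  by rewrite -[LHS]sqr_sqrtr ?h ?expr1n// addr_ge0 ?sqr_ge0.
by rewrite h sqrtr1.
Qed.

Lemma circle_pt_unit t : unit_circle (circle_pt t).
Proof. by apply/unit_circleE; rewrite /= cos2Dsin2. Qed.

Lemma dotzz z : unit_circle z -> dot z z = 1.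
Proof. by move=> /unit_circleE <-; rewrite /dot; ring. Qed.

Lemma dot_motion z : unit_circle z ->
  exists v, circular_motion 1 (fun t => dot z (circle_pt t)) v.
Proof. by move=> /unit_circleE/rotation_motion h; eexists; exact: h. Qed.

Lemma dot_norm_le1 z w : unit_circle z -> unit_circle w -> `|dot z w| <= 1.
Proof.
case: z w => [x y] [x' y'] /unit_circleE /= zE /unit_circleE /= wE.
rewrite /dot /= ler_norml; apply/andP; split.
  by have := sqr_ge0 (x + x'); have := sqr_ge0 (y + y'); rewrite !sqrrD; lra.
by have := sqr_ge0 (x - x'); have := sqr_ge0 (y - y'); rewrite !sqrrB; lra.
Qed.

(** Coordinates of the n-th tensor power of z. By [dotX] the kernel <z, w>^n
    is a weighted inner product of these vectors, hence positive semidefinite.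
    *)
Definition feature (n j : nat) z : R :=
  complex.Re z ^+ (n - j) * complex.Im z ^+ j.

Definition mean_feature (n j : nat) : R :=
  circle_mean (fun t => feature n j (circle_pt t)).

Lemma dotX n z w :
  dot z w ^+ n = \sum_(j < n.+1) 'C(n, j)%:R * (feature n j z * feature n j w).
Proof.
rewrite /dot exprDn; apply: eq_bigr => j _.
by rewrite /feature !exprMn -mulr_natl; ring.
Qed.

Lemma continuous_feature n j : continuous (fun t => feature n j (circle_pt t)).
Proof.
by apply: continuous_funM; apply: continuous_funX;
  [exact: continuous_cos|exact: continuous_sin].
Qed.

Lemma continuous_dot_circle_pt z : continuous (fun t => dot z (circle_pt t)).
Proof.
by apply: continuous_funD; apply: continuous_funZ;
  [exact: continuous_cos|exact: continuous_sin].
Qed.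

(** Both sides are the mean of <z, exp(i t)>^n: the inner product of the
    tensor power of z with the barycentre of the tensor powers of the circle
    does not depend on z. *)
Lemma moment_feature n z : unit_circle z ->
  \sum_(j < n.+1) 'C(n, j)%:R * (feature n j z * mean_feature n j) = moment n.
Proof.
move=> /dot_motion[v /moment_circular_motion <-].
transitivity (circle_mean (fun t =>
    \sum_(j < n.+1) ('C(n, j)%:R * feature n j z) * feature n j (circle_pt t))).
  rewrite (@circle_mean_sum _ n.+1 (fun j t => ('C(n,
    j)%:R * feature n j z) * feature n j (circle_pt t))).
    apply: eq_bigr => j _; rewrite circle_meanZ ?mulrA//.
    exact: continuous_feature.
  by move=> j; apply: continuous_funZ; exact: continuous_feature.
by apply: eq_circle_mean => t; rewrite dotX; apply: eq_bigr => j _; rewrite mulrA.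
Qed.

Lemma moment_mean_feature n :
  \sum_(j < n.+1) 'C(n, j)%:R * (mean_feature n j * mean_feature n j) = moment n.
Proof.
rewrite -[RHS](circle_mean_cst (moment n)).
transitivity (circle_mean (fun t =>
    \sum_(j < n.+1) ('C(n, j)%:R * mean_feature n j) * feature n j (circle_pt t))).
  rewrite (@circle_mean_sum _ n.+1 (fun j t => ('C(n,
    j)%:R * mean_feature n j) * feature n j (circle_pt t))).
    apply: eq_bigr => j _; rewrite circle_meanZ ?mulrA//.
    exact: continuous_feature.
  by move=> j; apply: continuous_funZ; exact: continuous_feature.
apply: eq_circle_mean => t; rewrite -(moment_feature n (circle_pt_unit t)).
by apply: eq_bigr => j _; rewrite -mulrA [mean_feature _ _ * _]mulrC.
Qed.

Definition power_average a (N n : nat) z : R :=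
  N%:R^-1 * \sum_(k < N) dot z (a k) ^+ n.

(** The squared norm of the difference between the average of the n-th tensor
    powers of the points and the barycentre of those of the circle. *)
Definition power_discrepancy a (N n : nat) : R :=
  N%:R^-1 ^+ 2 * (\sum_(i < N) \sum_(k < N) dot (a i) (a k) ^+ n) - moment n.

(** The left side is the square of the inner product of the discrepancy vector
    v with the tensor power of z, which has norm 1; the inequality is
    Cauchy-Schwarz, read off from the nonnegativity of |v - F z|^2. *)
Lemma sqr_power_average_le a N n z : (forall k, unit_circle (a k)) ->
  unit_circle z -> (0 < N)%N ->
  (power_average a N n z - moment n) ^+ 2 <= power_discrepancy a N n.
Proof.
move=> ua uz N0.
have N0' : N%:R != 0 :> R by rewrite pnatr_eq0 -lt0n.
pose C j : R := 'C(n, j)%:R.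
pose s j := N%:R^-1 * \sum_(k < N) feature n j (a k).
pose v j := s j - mean_feature n j.
have avgE w : power_average a N n w = \sum_(j < n.+1) C j * (feature n j w * s j).
  rewrite /power_average.
  under eq_bigr do rewrite dotX.
  rewrite exchange_big/=.
  rewrite mulr_sumr; apply: eq_bigr => j _.
  rewrite /s [feature n j w * _]mulrCA mulr_sumr !mulr_sumr.
  by apply: eq_bigr => k _; rewrite /C; ring.
have sE : N%:R^-1 * \sum_(k < N) power_average a N n (a k) =
    \sum_(j < n.+1) C j * (s j * s j).
  under eq_bigr do rewrite avgE.
  rewrite exchange_big/= mulr_sumr.
  apply: eq_bigr => j _; rewrite {2}/s [s j * _]mulrCA !mulr_sumr.
  by apply: eq_bigr => k _; ring.
have smE : \sum_(j < n.+1) C j * (s j * mean_feature n j) = moment n.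
  transitivity (N%:R^-1 * \sum_(k < N) (moment n : R)); last first.
    by rewrite sumr_const card_ord -[moment n *+ N]mulr_natl mulrA mulVf// mul1r.
  under [in RHS]eq_bigr => k _ do rewrite -(moment_feature n (ua k)).
  rewrite [in RHS]exchange_big/=.
  rewrite mulr_sumr; apply: eq_bigr => j _.
  rewrite /s -mulrA mulrCA mulr_suml !mulr_sumr.
  by apply: eq_bigr => k _; rewrite /C; ring.
have discE : power_discrepancy a N n = \sum_(j < n.+1) C j * v j ^+ 2.
  transitivity (\sum_(j < n.+1) (C j * (s j * s j) + (C j * (mean_feature n j *
    mean_feature n j) - 2 * (C j * (s j * mean_feature n j))))); last first.
    by apply: eq_bigr => j _; rewrite /v; ring.
  rewrite big_split sumrB/= -mulr_sumr smE moment_mean_feature -sE.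
  rewrite /power_discrepancy expr2 -mulrA [in LHS]mulr_sumr; ring.
set F := power_average a N n z - moment n.
have FE : F = \sum_(j < n.+1) C j * (feature n j z * v j).
  rewrite /F avgE -(moment_feature n uz) -sumrB.
  by apply: eq_bigr => j _; rewrite /v /C; ring.
have : 0 <= \sum_(j < n.+1) C j * (v j - F * feature n j z) ^+ 2.
  by apply: sumr_ge0 => j _; rewrite mulr_ge0 ?sqr_ge0 ?ler0n.
rewrite (_ : \sum_(j < _) _ = power_discrepancy a N n - F ^+ 2) ?subr_ge0//.
rewrite discE.
transitivity (\sum_(j < n.+1) (C j * v j ^+ 2 + (F ^+ 2 * (C j * (feature n j z
  * feature n j z)) - 2 * F * (C j * (feature n j z * v j))))).
  by apply: eq_bigr => j _; ring.
rewrite big_split sumrB/= -!mulr_sumr -FE -dotX dotzz// expr1n; ring.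
Qed.

Lemma power_discrepancy_ge0 a N n : (forall k, unit_circle (a k)) -> (0 < N)%N ->
  0 <= power_discrepancy a N n.
Proof. by move=> ua N0; apply: le_trans (sqr_power_average_le n ua (ua 0%N) N0);
  exact: sqr_ge0. Qed.

End discrepancy.

(** * Asymptotics of energy and potential *)

Section energy_asymptotics.
Context {R : realType}.

Definition taylor (b : nat -> R) (m : nat) (x : R) : R :=
  \sum_(n < m.*2) b n * x ^+ n.

Definition taylor_mean (b : nat -> R) (m : nat) : R :=
  \sum_(n < m.*2) b n * moment n.

(** What the asymptotics use of a kernel phi(<z, w>): the truncations of even
    length of one power series, with positive coefficients after the constant
    one, stay below phi, and their means over the circle converge to I. *)
Record energy_profile (phi : R -> R) (b : nat -> R) (I : R) : Prop := {
  profile_pos : forall n, 0 < b n.+1;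
  profile_ge : forall m x, -1 <= x -> x < 1 -> taylor b m.+1 x <= phi x;
  profile_mean_cvg : taylor_mean b m @[m --> \oo] --> I }.

(** The potential of the first n points at the point that is added next. *)
Definition next_potential (phi : R -> R) (a : nat -> R[i]) (n : nat) : R :=
  \sum_(k < n) phi (dot (a n) (a k)).

Definition real_energy (phi : R -> R) (a : nat -> R[i]) (N : nat) : R :=
  \sum_(i < N) \sum_(j < N | i != j) phi (dot (a i) (a j)).

(** The energy grows by twice the potential at each new point. *)
Lemma real_energyE phi a N :
  real_energy phi a N = 2 * \sum_(n < N) next_potential phi a n.
Proof.
elim: N => [|N ih]; first by rewrite /real_energy !big_ord0 mulr0.
rewrite big_ord_recr/= mulrDr -ih /real_energy big_ord_recr/=.
have -> : \sum_(i < N) \sum_(j < N.+1 | widen_ord (leqnSn N) i !=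
  j) phi (dot (a i) (a j))
    = \sum_(i < N) \sum_(j < N | i != j) phi (dot (a i) (a j))
      + \sum_(i < N) phi (dot (a i) (a N)).
  rewrite -big_split/=; apply: eq_bigr => i _.
  rewrite big_mkcond big_ord_recr/= -big_mkcond/=; congr (_ + _).
  by rewrite ifT// -val_eqE/= ltn_eqF.
have -> : \sum_(j < N.+1 | ord_max != j) phi (dot (a N) (a j)) =
   next_potential phi a N.
  rewrite big_mkcond big_ord_recr/= eqxx addr0; apply: eq_bigr => j _.
  by rewrite ifT// -val_eqE/= gtn_eqF.
have -> : \sum_(i < N) phi (dot (a i) (a N)) = next_potential phi a N.
  by apply: eq_bigr => j _; rewrite dotC.
ring.
Qed.

Section separated_greedy_points.
Variables (phi : R -> R) (b : nat -> R) (I : R) (a : nat -> R[i]) (p : nat).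
Hypothesis prof : energy_profile phi b I.
Hypothesis ua : forall n, unit_circle (a n).
Hypothesis a_neq : forall i j, i != j -> dot (a i) (a j) < 1.
Hypothesis greedy : forall n, (p < n)%N -> next_potential phi a n <= n%:R * I.

Lemma dot_ge i j : -1 <= dot (a i) (a j).
Proof. by have := dot_norm_le1 (ua i) (ua j); rewrite ler_norml => /andP[]. Qed.

(** Summing n I over n < N gives N (N - 1) I / 2; the finitely many initial
    points contribute a constant. *)
Lemma real_energy_le : exists K, forall N, real_energy phi a N <=
  N%:R ^+ 2 * I + K * N%:R.
Proof.
pose c n := `|next_potential phi a n - n%:R * I|.
pose C := \sum_(n < p.+1) c n.
have C0 : 0 <= C by apply: sumr_ge0 => n _; exact: normr_ge0.
(* the term |I| absorbs - N I when I is negative *)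
exists (`|I| + 2 * C) => N; rewrite real_energyE.
case: N => [|N]; first by rewrite big_ord0 !mulr0 expr0n/= mul0r addr0.
have H M : \sum_(n < M) next_potential phi a n <=
    \sum_(n < M) n%:R * I + \sum_(n < minn M p.+1) c n.
  elim: M => [|M ih]; first by rewrite min0n !big_ord0 addr0.
  rewrite !big_ord_recr/=.
  have [Mp|pM] := ltnP M p.+1.
    rewrite (minn_idPl _)//= big_ord_recr/=.
    move: ih; rewrite (minn_idPl (ltnW Mp)) => ih.
    have : next_potential phi a M - M%:R * I <= c M by exact: ler_norm.
    by move: ih; rewrite /=; lra.
  rewrite (minn_idPr _) 1?ltnW//.
  move: ih; rewrite (minn_idPr pM) => ih.
  have := greedy pM; lra.
have {H} := H N.+1.
have : \sum_(n < minn N.+1 p.+1) c n <= C.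
  rewrite /C -!(big_mkord xpredT c) [leRHS](@big_cat_nat _ _ _ (minn N.+1
    p.+1))/= ?geq_minr//.
  by rewrite lerDl; apply: sumr_ge0 => n _; exact: normr_ge0.
have : \sum_(n < N.+1) n%:R * I = N.+1%:R * N%:R / 2 * I :> R.
  rewrite -mulr_suml; congr (_ * _).
  elim: (N) => [|k ih]; first by rewrite big_ord1 mulr0 mul0r.
  by rewrite big_ord_recr/= ih -[in k.+2%:R]natr1 -natr1; field.
move=> -> h1 h2; rewrite -natr1.
have hI : - `|I| <= I by rewrite lerNl -normrN ler_norm.
have N0 : 0 <= N%:R :> R by exact: ler0n.
move: h2; rewrite -[N.+1%:R]natr1.
move: (N%:R) N0 => x x0 h2.
have : 0 <= C * x by exact: mulr_ge0.
have : 0 <= (`|I| + I) * (x + 1) by rewrite mulr_ge0//; lra.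
by move: h1 h2; lra.
Qed.

(** Off the diagonal phi is at least its Taylor truncation; completing the
    double sum with the diagonal turns each power into a moment plus a
    discrepancy, which is where positive semidefiniteness enters. *)
Lemma real_energy_ge m N : (0 < N)%N ->
  taylor_mean b m.+1 + \sum_(1 <= n < m.+1.*2) b n * power_discrepancy a N n
    - taylor b m.+1 1 / N%:R <= real_energy phi a N / N%:R ^+ 2.
Proof.
move=> N0; have N0' : 0 < N%:R :> R by rewrite ltr0n.
have : \sum_(i < N) \sum_(j < N | i != j) taylor b m.+1 (dot (a i) (a j)) <=
  real_energy phi a N.
  apply: ler_sum => i _; apply: ler_sum => j ij.
  by apply: (profile_ge prof); [exact: dot_ge|exact: a_neq].
have -> : \sum_(i < N) \sum_(j < N | i != j) taylor b m.+1 (dot (a i) (a j)) =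
   \sum_(i < N) \sum_(j < N) taylor b m.+1 (dot (a i) (a j)) - N%:R * taylor b m.+1 1.
  have -> : N%:R * taylor b m.+1 1 = \sum_(i < N) taylor b m.+1 1.
    by rewrite sumr_const card_ord mulr_natl.
  rewrite -sumrB; apply: eq_bigr => i _.
  rewrite [in RHS](bigD1 i)//= dotzz; last exact: ua.
  rewrite addrAC subrr add0r; apply: eq_bigl => j; by rewrite eq_sym.
have -> : \sum_(i < N) \sum_(j < N) taylor b m.+1 (dot (a i) (a j)) =
  N%:R ^+ 2 * (taylor_mean b m.+1 + \sum_(n < m.+1.*2) b n * power_discrepancy a N n).
  rewrite /taylor.
  under eq_bigr do rewrite exchange_big/=.
  rewrite exchange_big/= /taylor_mean -big_split/= mulr_sumr; apply: eq_bigr => n _.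
  rewrite /power_discrepancy.
  under eq_bigr do rewrite -mulr_sumr.
  rewrite -mulr_sumr; field.
  by rewrite gt_eqF.
have -> : \sum_(n < m.+1.*2) b n * power_discrepancy a N n =
    \sum_(1 <= n < m.+1.*2) b n * power_discrepancy a N n.
  rewrite -(big_mkord xpredT (fun n => b n * power_discrepancy a N n)) big_ltn//.
  (* the constant coefficient may be negative, but its discrepancy vanishes *)
  suff -> : power_discrepancy a N 0 = 0 by rewrite mulr0 add0r.
  rewrite /power_discrepancy/=.
  under eq_bigr do under eq_bigr do rewrite expr0.
  under eq_bigr do rewrite sumr_const card_ord.
  rewrite sumr_const card_ord -[_ *+ N]mulr_natl; field.
  by rewrite gt_eqF.
rewrite ler_pdivlMr ?exprn_gt0// => H.
apply: le_trans H; rewrite le_eqVlt; apply/orP; left; apply/eqP; field.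
by rewrite gt_eqF.
Qed.

(** The upper and lower bounds of the energy leave only I - J_m + O(1/N) for
    the sum of the discrepancies weighted by positive coefficients, where J_m
    is the mean of the m-th truncation. Letting N and then m grow, each
    discrepancy must vanish. *)
Lemma power_discrepancy_cvg n : power_discrepancy a N n.+1 @[N --> \oo] --> (0 : R).
Proof.
apply/cvgrPdist_lt => e e0.
have [K HK] := real_energy_le.
have b0 := profile_pos prof n.
have be0 : 0 < b n.+1 * e / 2 by rewrite divr_gt0// mulr_gt0.
have /cvgrPdist_lt/(_ _ be0) [m0 _ Hm0] := profile_mean_cvg prof.
pose m := maxn m0 n.+1.
have Jm : I - taylor_mean b m.+1 < b n.+1 * e / 2.
  have := Hm0 m.+1; rewrite /= /m; move/(_ (leq_trans (leq_maxl _ _) (leqnSn _))).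
  by apply: le_lt_trans; exact: ler_norm.
have KN := near_div_natr_lt (K + taylor b m.+1 1) be0.
near=> N.
have N0 : (0 < N)%N by near: N; exists 1%N.
have N0' : 0 < N%:R :> R by rewrite ltr0n.
have D0 k := power_discrepancy_ge0 k ua N0.
rewrite sub0r normrN ger0_norm//.
have h1 := real_energy_ge m N0.
have h2 : real_energy phi a N / N%:R ^+ 2 <= I + K / N%:R.
  rewrite ler_pdivrMr ?exprn_gt0//; apply: le_trans (HK N) _.
  rewrite le_eqVlt; apply/orP; left; apply/eqP; field.
  by rewrite gt_eqF.
have h3 : b n.+1 * power_discrepancy a N n.+1 <= \sum_(1 <=
  n < m.+1.*2) b n * power_discrepancy a N n.
  rewrite (bigD1_seq n.+1) ?iota_uniq //; last first.
    by rewrite mem_index_iota/= /m -addnn; have := leq_maxr m0 n.+1; lia.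
  rewrite lerDl big_seq_cond; apply: sumr_ge0 => -[|k].
    by rewrite mem_index_iota.
  by move=> _; rewrite mulr_ge0// ltW// (profile_pos prof).
have h4 : (K + taylor b m.+1 1) / N%:R < b n.+1 * e / 2 by near: N.
rewrite -(ltr_pM2l b0).
move: h4; rewrite mulrDl => h4; lra.
Unshelve. all: by end_near. Qed.

Lemma real_energy_cvg : real_energy phi a N / N%:R ^+ 2 @[N --> \oo] --> I.
Proof.
apply/cvgrPdist_lt => e e0.
have [K HK] := real_energy_le.
have e2 : 0 < e / 2 by rewrite divr_gt0.
have /cvgrPdist_lt/(_ _ e2) [m0 _ Hm0] := profile_mean_cvg prof.
have Jm : I - taylor_mean b m0.+1 < e / 2.
  by apply: le_lt_trans (Hm0 m0.+1 (leqnSn _)); exact: ler_norm.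
have KN := near_div_natr_lt K e0.
have TN := near_div_natr_lt (taylor b m0.+1 1) e2.
near=> N.
have N0 : (0 < N)%N by near: N; exists 1%N.
have N0' : 0 < N%:R :> R by rewrite ltr0n.
have h1 := real_energy_ge m0 N0.
have h2 : real_energy phi a N / N%:R ^+ 2 <= I + K / N%:R.
  rewrite ler_pdivrMr ?exprn_gt0//; apply: le_trans (HK N) _.
  rewrite le_eqVlt; apply/orP; left; apply/eqP; field.
  by rewrite gt_eqF.
have h3 : 0 <= \sum_(1 <= n < m0.+1.*2) b n * power_discrepancy a N n.
  rewrite big_seq_cond; apply: sumr_ge0 => -[|k]; first by rewrite mem_index_iota.
  by move=> _; rewrite mulr_ge0 ?power_discrepancy_ge0// ltW// (profile_pos prof).
have h4 : K / N%:R < e by near: N.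
have h5 : taylor b m0.+1 1 / N%:R < e / 2 by near: N.
rewrite ltr_norml; apply/andP; split; lra.
Unshelve. all: by end_near. Qed.

(** Uniformity in z is free: by Cauchy-Schwarz one discrepancy controls all
    the points of the circle. *)
Lemma power_average_unif_cvg n (e : R) : 0 < e ->
  \forall N \near \oo, forall z, unit_circle z ->
    `|power_average a N n z - moment n| < e.
Proof.
move=> e0; case: n => [|n].
  near=> N; move=> z uz.
  have N0 : (0 < N)%N by near: N; exists 1%N.
  rewrite /power_average; under eq_bigr do rewrite expr0.
  by rewrite sumr_const card_ord mulVf ?subrr ?normr0// pnatr_eq0 -lt0n.
have e2 : 0 < e ^+ 2 by rewrite exprn_gt0.
have /cvgrPdist_lt/(_ _ e2) Hd := power_discrepancy_cvg n.
near=> N; move=> z uz.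
have N0 : (0 < N)%N by near: N; exists 1%N.
rewrite -(@ltr_pXn2r _ 2)// ?nnegrE// ?(ltW e0)// real_normK ?num_real//.
apply: le_lt_trans (sqr_power_average_le n.+1 ua uz N0) _.
have : `|0 - power_discrepancy a N n.+1| < e ^+ 2 by near: N.
by apply: le_lt_trans; rewrite sub0r normrN ler_norm.
Unshelve. all: by end_near. Qed.

Lemma poly_average_unif_cvg (c : nat -> R) M (e : R) : 0 < e ->
  \forall N \near \oo, forall z, unit_circle z ->
   `|N%:R^-1 * (\sum_(k < N) \sum_(n < M) c n * dot z (a k) ^+ n) -
     \sum_(n < M) c n * moment n| < e.
Proof.
suff H : 0 < e -> \forall N \near \oo, forall z, unit_circle z ->
   `|\sum_(n < M) c n * (power_average a N n z - moment n)| < e.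
  move=> e0; near=> N; move=> z uz; rewrite exchange_big/= mulr_sumr -sumrB.
  under eq_bigr do rewrite -mulr_sumr mulrCA -mulrBr.
  by move: z uz; near: N; exact: H.
elim: M e => [|M ih] e e0.
  by near=> N; move=> z _; rewrite big_ord0 normr0.
have e2 : 0 < e / 2 by rewrite divr_gt0.
have c0 : 0 < e / 2 / (`|c M| + 1) by rewrite divr_gt0// ltr_wpDl.
have H1 := ih _ e2.
have H2 := power_average_unif_cvg M c0.
near=> N; move=> z uz; rewrite big_ord_recr/=.
have h1 : `|\sum_(n < M) c n * (power_average a N n z - moment n)| < e / 2.
  by move: z uz; near: N.
have h2 : `|power_average a N M z - moment M| < e / 2 / (`|c M| + 1).
  by clear h1; move: z uz; near: N.
apply: le_lt_trans (ler_normD _ _) _; rewrite normrM.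
have : `|c M| * `|power_average a N M z - moment M| <= e / 2.
  move: h2; rewrite ltr_pdivlMr ?ltr_wpDl// => /ltW h2.
    by apply: le_trans h2; rewrite mulrC ler_wpM2l// lerDl.
by move=> h3; lra.
Unshelve. all: by end_near. Qed.

(** The upper bound is the greedy condition. For the lower bound the potential
    is at least the average of the Taylor truncation, whose convergence is
    uniform in the point at which it is evaluated. *)
Lemma next_potential_cvg : next_potential phi a N / N%:R @[N --> \oo] --> I.
Proof.
apply/cvgrPdist_lt => e e0.
have e2 : 0 < e / 2 by rewrite divr_gt0.
have /cvgrPdist_lt/(_ _ e2) [m0 _ Hm0] := profile_mean_cvg prof.
have Jm : I - taylor_mean b m0.+1 < e / 2.
  by apply: le_lt_trans (Hm0 m0.+1 (leqnSn _)); exact: ler_norm.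
have HP := poly_average_unif_cvg b m0.+1.*2 e2.
near=> N.
have N0 : (0 < N)%N by near: N; exists 1%N.
have N0' : 0 < N%:R :> R by rewrite ltr0n.
have Np : (p < N)%N by near: N; exists p.+1.
have h1 : next_potential phi a N / N%:R <= I.
  by rewrite ler_pdivrMr// mulrC; exact: greedy.
have h2 : N%:R^-1 * (\sum_(k < N) taylor b m0.+1 (dot (a N) (a k))) <=
  next_potential phi a N / N%:R.
  rewrite mulrC ler_pM2r ?invr_gt0//; apply: ler_sum => k _.
  by apply: (profile_ge prof); [exact: dot_ge|apply: a_neq; rewrite gtn_eqF].
have : `|N%:R^-1 * (\sum_(k < N) taylor b m0.+1 (dot (a N) (a k))) - taylor_mean
  b m0.+1| < e / 2.
  by move: (a N) (ua N); near: N.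
rewrite !ltr_norml => /andP[h3 h4]; apply/andP; split; lra.
Unshelve. all: by end_near. Qed.

End separated_greedy_points.
End energy_asymptotics.

(** * Taylor expansion of the kernel *)

Section riesz_profile.
Context {R : realType}.

(** On the circle |z - w|^2 = 2 (1 - <z, w>), so the kernel is a function of x
    = <z, w>. *)
Definition riesz_profile (s x : R) : R :=
  if s == 0 then - ln (2 * (1 - x)) / 2 else (2 * (1 - x)) `^ (- (s / 2)).

(** Taylor coefficients of (1 - x)^(- al) at 0. *)
Fixpoint binomial_coef (al : R) (n : nat) : R :=
  if n is k.+1 then (k%:R + al) / k.+1%:R * binomial_coef al k else 1.

Definition riesz_coef (s : R) (n : nat) : R :=
  if s == 0 then (if n is k.+1 then k.+1%:R^-1 / 2 else - ln 2 / 2)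
  else 2 `^ (- (s / 2)) * binomial_coef (s / 2) n.

Lemma binomial_coefS al n :
  n.+1%:R * binomial_coef al n.+1 = (n%:R + al) * binomial_coef al n.
Proof. by rewrite /= mulrA mulrCA mulfV ?pnatr_eq0// mulr1. Qed.

Lemma binomial_coef_gt0 al n : 0 < al -> 0 < binomial_coef al n.
Proof.
move=> a0; elim: n => [|n ih] //; rewrite -(@pmulr_rgt0 _ n.+1%:R) ?ltr0n//.
by rewrite binomial_coefS mulr_gt0// ltr_wpDl.
Qed.

Lemma binomial_coef_decr al n : 0 < al -> al <= 1 ->
  binomial_coef al n.+1 <= binomial_coef al n.
Proof.
move=> a0 a1; rewrite -(@ler_pM2l _ n.+1%:R) ?ltr0n// binomial_coefS.
by rewrite ler_pM2r ?binomial_coef_gt0// -natr1 lerD2l.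
Qed.

Lemma binomial_coef_le1 al n : 0 < al -> al <= 1 -> binomial_coef al n <= 1.
Proof.
move=> a0 a1; elim: n => [|n ih] //.
exact: le_trans (binomial_coef_decr n a0 a1) ih.
Qed.

Lemma riesz_coef_gt0 s n : 0 <= s -> 0 < riesz_coef s n.+1.
Proof.
move=> s0; rewrite /riesz_coef; case: eqP => [_|/eqP s_neq0].
  by rewrite divr_gt0// invr_gt0 ltr0n.
have {}s0 : 0 < s by rewrite lt_def s_neq0.
by rewrite mulr_gt0 ?powR_gt0// binomial_coef_gt0// divr_gt0.
Qed.

Lemma riesz_coef_decr s n : 0 <= s -> s < 1 ->
  riesz_coef s n.+2 <= riesz_coef s n.+1.
Proof.
move=> s0 s1; rewrite /riesz_coef; case: eqP => [_|/eqP s_neq0].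
  by rewrite ler_pM2r// lef_pV2 ?posrE ?ltr0n// ler_nat.
have {}s0 : 0 < s by rewrite lt_def s_neq0.
rewrite ler_pM2l ?powR_gt0//; apply: binomial_coef_decr; lra.
Qed.

(** For odd M such an H decreases before 0 and increases after it, so 0 is its
    minimum; both bounds come from the mean value theorem between 0 and x. *)
Lemma odd_remainder (H : R -> R) (K be : R) (M : nat) : odd M -> 0 <= K -> be <= 0 ->
  H 0 = 0 ->
  (forall x, x < 1 -> is_derive (x : R) (1 : R) H (K * x ^+ M * (1 - x) `^ be)) ->
  forall x, x < 1 ->
    0 <= H x /\ (`|x| < 1 -> H x <= K * `|x| ^+ M * (1 - `|x|) `^ be).
Proof.
move=> oM K0 be0 H0 dH x x1.
have cH a b : b < 1 -> {within `[a, b], continuous H}.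
  move=> b1; apply: continuous_in_subspaceT => y; rewrite inE/= in_itv/= => /andP[_ yb].
  have [d _] := dH y (le_lt_trans yb b1).
  exact/differentiable_continuous/derivable1_diffP.
have [->|xn0] := eqVneq x 0.
  rewrite H0; split=> // _.
  by rewrite mulr_ge0 ?powR_ge0// mulr_ge0// exprn_ge0.
(* c is the intermediate point of the mean value theorem; x c^M >= 0 since x
   and c have the same sign and M is odd *)
have [c [cx cx' c0 HE]] : exists c, [/\ `|c| <= `|x|, c < 1, 0 <= x * c ^+ M &
    H x = K * c ^+ M * (1 - c) `^ be * x].
  have [x0|x0|/eqP] := ltgtP x 0; last by rewrite (negbTE xn0).
    have [|c] := @MVT _ H (fun x => K * x ^+ M * (1 - x) `^ be) x 0 x0 _ (cH _ _ ltr01).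
      by move=> y; rewrite in_itv/= => /andP[_ y0]; apply: dH; exact: lt_trans y0 _.
    rewrite in_itv/= H0 !sub0r mulrN => /andP[xc c0] /eqP.
    rewrite eqr_opp => /eqP HE; exists c; split => //.
    - by rewrite !ltr0_norm// lerN2 ltW.
    - exact: lt_trans c0 _.
    - by rewrite nmulr_rge0// exprn_odd_le0// ltW.
  have [|c] := @MVT _ H (fun x => K * x ^+ M * (1 - x) `^ be) 0 x x0 _ (cH _ _ x1).
    by move=> y; rewrite in_itv/= => /andP[_ y0]; apply: dH; exact: lt_trans y0 _.
  rewrite in_itv/= H0 !subr0 => /andP[c0 xc] HE; exists c; split => //.
  - by rewrite !gtr0_norm// ltW.
  - exact: lt_trans xc _.
  - by rewrite mulr_ge0// ?exprn_ge0// ltW.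
split.
  rewrite HE mulrC -mulrA mulrCA mulr_ge0// mulrA mulr_ge0 ?powR_ge0//.
move=> ax1.
have -> : H x = K * (x * c ^+ M) * (1 - c) `^ be by rewrite HE; ring.
have h1 : x * c ^+ M <= `|x| ^+ M.
  apply: le_trans (ler_norm _) _; rewrite normrM normrX.
  apply: (@le_trans _ _ (1 * `|c| ^+ M)).
    by rewrite ler_wpM2r// ?exprn_ge0// ltW.
  by rewrite mul1r lerXn2r ?nnegrE.
have h2 : (1 - c) `^ be <= (1 - `|x|) `^ be.
  have c1 : 0 < 1 - c by lra.
  have ax : 0 < 1 - `|x| by lra.
  rewrite -[be]opprK !(powRN _ (- be)) lef_pV2 ?posrE ?powR_gt0//.
  apply: ge0_ler_powR; rewrite ?oppr_ge0// ?nnegrE; [exact: ltW|exact: ltW|].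
  by have := ler_norm c; lra.
apply: ler_pM => //; first by rewrite mulr_ge0.
  exact: powR_ge0.
by rewrite ler_wpM2l.
Qed.

Lemma is_derive_1Mpow (al x : R) : x < 1 ->
  is_derive (x : R) (1 : R) (fun t => (1 - t) `^ al) (- (al * (1 - x) `^ (al - 1))).
Proof.
move=> x1; have x0 : 0 < 1 - x by rewrite subr_gt0.
have d1 : is_derive (x : R) (1 : R) (fun t : R => 1 - t) (-1).
  by apply: (is_derive_eq (is_deriveB (is_derive_cst (1:R) (x:R) (1:R))
    (is_derive_id (x : R) (1:R)))); rewrite sub0r.
have h := @is_derive1_comp R (@powR R ^~ al) (fun t =>
  1 - t) x _ _ (is_derive1_powR al x0) d1.
by apply: (is_derive_eq h); rewrite mulrN1.
Qed.

Lemma is_derive_ln1M (x : R) : x < 1 ->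
  is_derive (x : R) (1 : R) (fun t => ln (1 - t)) (- (1 - x)^-1).
Proof.
move=> x1; have x0 : 0 < 1 - x by rewrite subr_gt0.
have d1 : is_derive (x : R) (1 : R) (fun t : R => 1 - t) (-1).
  by apply: (is_derive_eq (is_deriveB (is_derive_cst (1:R) (x:R) (1:R))
    (is_derive_id (x : R) (1:R)))); rewrite sub0r.
have h := @is_derive1_comp R (@ln R) (fun t => 1 - t) x _ _ (is_derive1_ln x0) d1.
by apply: (is_derive_eq h); rewrite mulrN1.
Qed.

(** The partial sum S of degree M satisfies (1 - x) S' = al S - (M + al) b_M
    x^M, so the derivative of 1 - (1 - x)^al S reduces to the single term
    required by [odd_remainder]. *)
Lemma binomial_remainder (al x : R) (M : nat) : 0 < al -> al < 1 -> odd M -> x < 1 ->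
  let r := 1 - (1 - x) `^ al * \sum_(n < M.+1) binomial_coef al n * x ^+ n in
  0 <= r /\ (`|x| < 1 -> r <= M.+1%:R * `|x| ^+ M * (1 - `|x|) `^ (al - 1)).
Proof.
move=> a0 a1 oM x1 /=.
pose S M (x : R) := \sum_(n < M.+1) binomial_coef al n * x ^+ n.
have dS : exists S', forall x, is_derive (x : R) (1 : R) (S M) (S' x) /\
    (1 - x) * S' x = al * S M x - (M%:R + al) * binomial_coef al M * x ^+ M.
  elim: M {oM} => [|M [S' ih]].
    exists (fun=> 0) => y; split.
      rewrite (_ : S 0%N = cst 1); first exact: is_derive_cst.
      by apply/funext => u; rewrite /S big_ord1 expr0 mulr1.
    by rewrite /S big_ord1/=; ring.
  exists (fun y => S' y + binomial_coef al M.+1 * (M.+1%:R * y ^+ M * 1)) => y.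
  have [d e] := ih y; split.
    rewrite (_ : S M.+1 = (fun y => S M y + binomial_coef al M.+1 * y ^+ M.+1)).
      apply: (is_derive_funD d); apply: is_derive_funZ.
      exact: (is_derive_funX M (is_derive_id (y : R) (1 : R))).
    by apply/funext => u; rewrite /S big_ord_recr.
  have -> : S M.+1 y = S M y + binomial_coef al M.+1 * y ^+ M.+1.
    by rewrite /S big_ord_recr.
  have E := binomial_coefS al M.
  rewrite mulrDr e.
  have -> : (M%:R + al) * binomial_coef al M * y ^+ M =
    M.+1%:R * binomial_coef al M.+1 * y ^+ M.
    by rewrite E.
  by rewrite exprS; ring.
case: dS => S' dS.
have dH y : y < 1 -> is_derive (y : R) (1 : R) (fun y => 1 - (1 - y) `^ al * S M y)
   ((M%:R + al) * binomial_coef al M * y ^+ M * (1 - y) `^ (al - 1)).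
  move=> y1; have [d e] := dS y.
  apply: (is_derive_eq (is_deriveB (is_derive_cst (1:R) (y:R) (1:R))
    (is_derive_funM (is_derive_1Mpow al y1) d))).
  have y0 : 0 <= 1 - y by lra.
  rewrite -(mulr_powRB1 y0 a0) sub0r.
  transitivity (- ((1 - y) `^ (al - 1) * ((1 - y) * S' y - al * S M y))); first by ring.
  by rewrite e; ring.
have K0 : 0 <= (M%:R + al) * binomial_coef al M.
  by rewrite mulr_ge0// ?addr_ge0// ltW// binomial_coef_gt0.
have H0 : 1 - (1 - 0) `^ al * S M 0 = 0.
  rewrite subr0 powR1 mul1r /S big_ord_recl/= expr0 mul1r big1 ?addr0 ?subrr//.
  by move=> i _; rewrite expr0n/= mulr0.
have be0 : al - 1 <= 0 by lra.
have [h1 h2] := odd_remainder oM K0 be0 H0 dH x1.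
split => // ax; apply: le_trans (h2 ax) _.
rewrite ler_wpM2r ?powR_ge0// ler_wpM2r ?exprn_ge0//.
rewrite -[leRHS]mulr1; apply: ler_pM.
- by rewrite addr_ge0// ltW.
- by rewrite ltW// binomial_coef_gt0.
- by rewrite -natr1 lerD2l ltW.
- exact: (binomial_coef_le1 _ a0 (ltW a1)).
Qed.

(** The partial sum S of degree M satisfies (1 - x) S' = 1 - x^M, so the
    remainder has derivative x^M / (1 - x). *)
Lemma log_remainder (x : R) (M : nat) : odd M -> x < 1 ->
  let r := - ln (1 - x) - \sum_(n < M) n.+1%:R^-1 * x ^+ n.+1 in
  0 <= r /\ (`|x| < 1 -> r <= M.+1%:R * `|x| ^+ M * (1 - `|x|) `^ (- 1)).
Proof.
move=> oM x1 /=.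
pose S M (x : R) := \sum_(n < M) n.+1%:R^-1 * x ^+ n.+1.
have dS : exists S', forall x, is_derive (x : R) (1 : R) (S M) (S' x) /\
    (1 - x) * S' x = 1 - x ^+ M.
  elim: M {oM} => [|M [S' ih]].
    exists (fun=> 0) => y; split; last by rewrite expr0 mulr0 subrr.
    rewrite (_ : S 0%N = cst 0); first exact: is_derive_cst.
    by apply/funext => u; rewrite /S big_ord0.
  exists (fun y => S' y + M.+1%:R^-1 * (M.+1%:R * y ^+ M * 1)) => y.
  have [d e] := ih y; split.
    rewrite (_ : S M.+1 = (fun y => S M y + M.+1%:R^-1 * y ^+ M.+1)).
      apply: (is_derive_funD d); apply: is_derive_funZ.
      exact: (is_derive_funX M (is_derive_id (y : R) (1 : R))).
    by apply/funext => u; rewrite /S big_ord_recr.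
  by rewrite mulrDr e mulr1 mulKf ?pnatr_eq0// exprS; ring.
case: dS => S' dS.
have dH y : y < 1 -> is_derive (y : R) (1 : R) (fun y => - ln (1 - y) - S M y)
   (1 * y ^+ M * (1 - y) `^ (- 1)).
  move=> y1; have [d e] := dS y.
  apply: (is_derive_eq (is_deriveB (is_deriveN (is_derive_ln1M y1)) d)).
  have y0 : 0 < 1 - y by lra.
  rewrite powR_inv1 1?ltW// opprK mul1r.
  apply: (@mulfI _ (1 - y)); first by rewrite gt_eqF.
  rewrite mulrBr e mulfV ?gt_eqF// mulrCA mulfV ?gt_eqF//; ring.
have H0 : - ln (1 - 0) - S M 0 = 0.
  rewrite subr0 ln1 oppr0 sub0r /S big1 ?oppr0// => i _.
  by rewrite expr0n/= mulr0.
have [|h1 h2] := odd_remainder oM ler01 _ H0 dH x1; first by rewrite oppr_le0.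
split => // ax; apply: le_trans (h2 ax) _.
rewrite ler_wpM2r ?powR_ge0// ler_wpM2r ?exprn_ge0//.
by rewrite ler1n.
Qed.

Lemma riesz_taylor_remainder (s x : R) : 0 <= s -> s < 1 -> x < 1 ->
  (forall m, taylor (riesz_coef s) m.+1 x <= riesz_profile s x) /\
  (`|x| < 1 -> exists C, forall m, riesz_profile s x - taylor (riesz_coef s) m.+1 x
     <= C * (m.+1.*2%:R * `|x| ^+ m.*2.+1)).
Proof.
move=> s0 s1 x1; have x0 : 0 < 1 - x by lra.
have oM m : odd m.*2.+1 by rewrite /= odd_double.
rewrite /riesz_profile /taylor /riesz_coef; case: eqP => [_|/eqP s_neq0].
  have E m : - ln (2 * (1 - x)) / 2 -
     \sum_(n < m.+1.*2) (match nat_of_ord n with 0 => - ln 2 / 2 | k.+1 =>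
       k.+1%:R^-1 / 2 end) * x ^+ n =
     (- ln (1 - x) - \sum_(n < m.*2.+1) n.+1%:R^-1 * x ^+ n.+1) / 2.
    rewrite doubleS big_ord_recl/= expr0 mulr1 lnM ?posrE//.
    rewrite mulrBl mulr_suml.
    rewrite (eq_bigr (fun i : 'I_m.*2.+1 => i.+1%:R^-1 * x ^+ i.+1 / 2)); last first.
      by move=> i _; rewrite /bump/= add1n; ring.
    ring.
  split.
    move=> m; rewrite -subr_ge0 E divr_ge0//.
    by have [] := log_remainder (oM m) x1.
  move=> ax; exists ((1 - `|x|) `^ (-1)) => m; rewrite E.
  have [h1 /(_ ax) h2] := log_remainder (oM m) x1.
  rewrite doubleS [leRHS]mulrC; apply: le_trans h2; lra.
have {}s0 : 0 < s / 2 by rewrite divr_gt0// lt_def s_neq0.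
have s2 : s / 2 < 1 by lra.
have p0 : 0 < (1 - x) `^ (s / 2) by rewrite powR_gt0.
have q0 : 0 < 2 `^ (s / 2) by rewrite powR_gt0.
have E m : (2 * (1 - x)) `^ (- (s / 2)) -
     \sum_(n < m.+1.*2) 2 `^ (- (s / 2)) * binomial_coef (s / 2) n * x ^+ n =
     ((2 `^ (s / 2) * (1 - x) `^ (s / 2)))^-1 * (1 - (1 - x) `^ (s / 2) *
       \sum_(n < m.+1.*2) binomial_coef (s / 2) n * x ^+ n).
  rewrite !powRN powRM ?ltW//.
  under eq_bigr do rewrite -mulrA.
  rewrite -mulr_sumr; field.
  by rewrite !gt_eqF.
split.
  move=> m; rewrite -subr_ge0 E mulr_ge0// ?invr_ge0 ?mulr_ge0 ?powR_ge0//.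
  by have [] := binomial_remainder s0 s2 (oM m) x1.
move=> ax; exists ((2 `^ (s / 2) * (1 - x) `^ (s / 2))^-1 * (1 - `|x|) `^ (s / 2
  - 1)) => m.
rewrite E -mulrA ler_wpM2l ?invr_ge0 ?mulr_ge0 ?powR_ge0//.
have [h1 /(_ ax) h2] := binomial_remainder s0 s2 (oM m) x1.
by rewrite doubleS [leRHS]mulrC.
Qed.

(** The product (m+1) r^m is at most 1 + r + ... + r^m <= 1 / (1 - r), which
    leaves a factor r^m that tends to 0. *)
Lemma cvg_natr_expr (r : R) : 0 <= r -> r < 1 ->
  m.+1.*2%:R * r ^+ m.*2.+1 @[m --> \oo] --> (0 : R).
Proof.
move=> r0 r1; have r2 : 0 < 1 - r by lra.
have bnd k : k.+1%:R * r ^+ k <= (1 - r)^-1.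
  rewrite -[leRHS]mul1r ler_pdivlMr//.
  have -> : k.+1%:R * r ^+ k = \sum_(i < k.+1) r ^+ k.
    by rewrite sumr_const card_ord mulr_natl.
  apply: (@le_trans _ _ ((\sum_(i < k.+1) r ^+ i) * (1 - r))).
    apply: ler_wpM2r; [exact: ltW|apply: ler_sum => i _].
    by apply: ler_wiXn2l => //; [exact: ltW|rewrite -ltnS].
  rewrite mulrC -opprB mulNr -subrX1 opprB lerBlDr lerDl; exact: exprn_ge0.
have : 2 * (1 - r)^-1 * r ^+ m @[m --> \oo] --> (2 * (1 - r)^-1 * 0 : R).
  by apply: cvgMr; apply: cvg_expr; rewrite ger0_norm.
rewrite mulr0; apply: squeeze_cvgr; last exact: cvg_cst.
apply: nearW => m; rewrite mulr_ge0 ?exprn_ge0//=.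
have -> : m.+1.*2%:R * r ^+ m.*2.+1 = 2 * (m.+1%:R * r ^+ m * r) * r ^+ m.
  by rewrite -[m.*2]addnn exprS exprD -muln2 natrM; ring.
rewrite ler_wpM2r ?exprn_ge0// ler_wpM2l//.
apply: le_trans (bnd m); rewrite ler_piMr ?mulr_ge0 ?exprn_ge0// ltW//.
Qed.

Lemma taylor_le_riesz_profile (s x : R) m : 0 <= s -> s < 1 -> x < 1 ->
  taylor (riesz_coef s) m.+1 x <= riesz_profile s x.
Proof. by move=> s0 s1 x1; have [] := riesz_taylor_remainder s0 s1 x1. Qed.

Lemma taylor_cvg_riesz_profile (s x : R) : 0 <= s -> s < 1 -> `|x| < 1 ->
  taylor (riesz_coef s) m.+1 x @[m --> \oo] --> riesz_profile s x.
Proof.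
move=> s0 s1 ax; have x1 : x < 1 by exact: le_lt_trans (ler_norm x) ax.
have [h1 /(_ ax)[C h2]] := riesz_taylor_remainder s0 s1 x1.
have cC : riesz_profile s x - C * (m.+1.*2%:R * `|x| ^+ m.*2.+1) @[m -->
  \oo] --> (riesz_profile s x - C * 0 : R).
  by apply: cvgB; [exact: cvg_cst|apply: cvgMr; exact: cvg_natr_expr].
rewrite mulr0 subr0 in cC.
apply: squeeze_cvgr cC (cvg_cst _).
by apply: nearW => m; rewrite h1 andbT lerBlDr -lerBlDl.
Qed.

End riesz_profile.

(** * Means of the kernel as monotone limits *)

Section ereal_mean.
Context {R : realType}.
Local Notation mu := (@lebesgue_measure R).

Definition circle_emean (F : R -> \bar R) : \bar R :=
  ((2 * pi)^-1%:E * \int[mu]_(t in `[0%R, (2 * pi)%R]) F t)%E.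

Lemma circle_emean_fin (g : R -> R) : continuous g ->
  circle_emean (fun t => (g t)%:E) = (circle_mean g)%:E.
Proof.
move=> cg; rewrite /circle_emean /circle_mean /Rintegral EFinM fineK//.
by apply: integrable_fin_num => //; exact: continuous_integrable02pi.
Qed.

(** Extended-valued form of [riesz_profile], with the value of the kernel on
    the diagonal. *)
Definition riesz_eprofile (s x : R) : \bar R :=
  if x == 1 then +oo%E else (riesz_profile s x)%:E.

Lemma measurable_riesz_profile (s : R) : measurable_fun [set: R] (riesz_profile s).
Proof.
have mB : measurable_fun [set: R] (fun x : R => 2 * (1 - x)).
  apply: continuous_measurable_fun; apply: continuous_funZ => x.
  by apply: cvgB; [exact: cvg_cst|exact: cvg_id].
rewrite /riesz_profile; case: eqP => _.
  apply: measurable_funM => //.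
  by apply: measurableT_comp => //; exact: measurableT_comp (@measurable_ln R) mB.
exact: (measurableT_comp (@measurable_powR R _) mB).
Qed.

Lemma measurable_riesz_eprofile (s : R) :
  measurable_fun [set: R] (riesz_eprofile s).
Proof.
apply: measurable_fun_ifT => //.
  exact: measurable_fun_eqr.
by apply/measurable_EFinP; exact: measurable_riesz_profile.
Qed.

(** A constant that makes the kernel and all its truncations nonnegative once
    it is added to them. *)
Definition riesz_shift (s : R) : R := `|riesz_coef s 0| + `|riesz_coef s 1|.

(** The two new terms add up to x^(2k) (b_(2k) + b_(2k+1) x), which is
    nonnegative because the coefficients decrease. *)
Lemma taylor_nondecr s m (x : R) : 0 <= s -> s < 1 -> `|x| <= 1 ->
  taylor (riesz_coef s) m.+1 x <= taylor (riesz_coef s) m.+2 x.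
Proof.
move=> s0 s1 x1.
rewrite [leRHS]/taylor doubleS big_ord_recr big_ord_recr/= -addrA.
rewrite lerDl exprSr mulrA; have -> : m.+1.*2 = m.*2.+2 by [].
have b1 := riesz_coef_decr (m.*2).+1 s0 s1.
have b0 := riesz_coef_gt0 (m.*2).+2 s0.
have xx : 0 <= x ^+ m.*2.+2 by rewrite -doubleS -muln2 mulnC exprM exprn_ge0// sqr_ge0.
move: b1 b0; set b := riesz_coef s m.*2.+2; set b' := riesz_coef s m.*2.+3 => b1 b0.
rewrite [_ * _ * x]mulrAC -mulrDl mulr_ge0//.
have : - b' <= b' * x.
  by rewrite -mulrN1 ler_pM2l//; move: x1; rewrite ler_norml => /andP[].
by lra.
Qed.

Lemma taylor_ge s m (x : R) : 0 <= s -> s < 1 -> `|x| <= 1 ->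
  - riesz_shift s <= taylor (riesz_coef s) m.+1 x.
Proof.
move=> s0 s1 x1; elim: m => [|m ih]; last first.
  by apply: le_trans ih _; exact: taylor_nondecr.
rewrite /taylor big_ord_recr big_ord_recr big_ord0/= add0r expr0 mulr1 expr1.
rewrite /riesz_shift opprD lerD//.
  by rewrite lerNl -normrN ler_norm.
rewrite lerNl -mulrN; apply: le_trans (ler_norm _) _.
by rewrite normrM normrN ler_piMr.
Qed.

Lemma riesz_profile_ge s (x : R) : 0 <= s -> s < 1 -> -1 <= x -> x < 1 ->
  - riesz_shift s <= riesz_profile s x.
Proof.
move=> s0 s1 x0 x1; apply: le_trans (taylor_le_riesz_profile 0 s0 s1 x1).
by apply: taylor_ge => //; rewrite ler_norml x0 ltW.
Qed.

Lemma continuous_taylor b m (u : R -> R) : continuous u ->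
  continuous (fun t => taylor b m (u t)).
Proof.
move=> cu; apply: (@continuous_fun_sum _ m.*2 (fun n t => b n * u t ^+ n)) => n.
by apply: continuous_funZ; exact: continuous_funX.
Qed.

(** Monotone convergence for the truncations, shifted to be nonnegative. They
    converge to the kernel wherever |u| < 1, hence almost everywhere. *)
Lemma riesz_emean_cvg s (u : R -> R) (c : nat -> R) (C : R) : 0 <= s -> s < 1 ->
  continuous u -> (forall t, `|u t| <= 1) ->
  mu.-negligible (`[0, 2 * pi] `&` [set t | `|u t| = 1]) ->
  (forall n, circle_mean (fun t => u t ^+ n) = c n) ->
  riesz_shift s <= C ->
  (\sum_(n < m.+1.*2) riesz_coef s n * c n + C)%:E @[m --> \oo] -->
    circle_emean (fun t => riesz_eprofile s (u t) + C%:E)%E.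
Proof.
move=> s0 s1 cu u1 negl uc CC.
pose g m t := taylor (riesz_coef s) m.+1 (u t) + C.
have cg m : continuous (g m).
  by apply: continuous_funD; [exact: continuous_taylor|exact: cst_continuous].
have g0 m t : 0 <= g m t.
  by have := taylor_ge m s0 s1 (u1 t); rewrite /g; lra.
have gnd t m n : (m <= n)%N -> g m t <= g n t.
  move=> mn; rewrite -(subnKC mn); elim: (n - m)%N => [|k ih]; first by rewrite addn0.
  by apply: le_trans ih _; rewrite addnS /g lerD2r taylor_nondecr.
have gE m : circle_mean (g m) = \sum_(n < m.+1.*2) riesz_coef s n * c n + C.
  rewrite circle_meanD ?circle_mean_cst; last 2 first.
  - exact: continuous_taylor.
  - exact: cst_continuous.
  congr (_ + _); rewrite /taylor.
  rewrite (@circle_mean_sum _ m.+1.*2 (fun n t => riesz_coef s n * u t ^+ n)).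
    by apply: eq_bigr => n _; rewrite circle_meanZ ?uc//; exact: continuous_funX.
  by move=> n; apply: continuous_funZ; exact: continuous_funX.
have mg m : measurable_fun `[0, 2 * pi] (fun t => (g m t)%:E).
  by apply/measurable_EFinP; apply: measurable_funTS; exact: continuous_measurable_fun.
have mI : measurable (`[0, 2 * pi]%classic : set R) by [].
have limE : (\int[mu]_(t in `[0%R, (2 * pi)%R]) (riesz_eprofile s (u t) + C%:E) =
   \int[mu]_(t in `[0%R, (2 * pi)%R]) (limn (fun m => (g m t)%:E)))%E.
  apply: ae_eq_integral => //.
  - apply: measurable_funTS; apply: emeasurable_funD => //.
    exact: measurableT_comp (measurable_riesz_eprofile s)
      (continuous_measurable_fun cu).
  - apply: (emeasurable_fun_cvg (fun m t => (g m t)%:E)) => // t _.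
    by apply: ereal_nondecreasing_is_cvgn => m n mn; rewrite lee_fin gnd.
  - apply: negligibleS negl => t /=.
    move=> /not_implyP[tI H]; split => //; apply: contrapT => /eqP ut1; apply: H.
    have {}ut1 : `|u t| < 1 by rewrite lt_neqAle ut1 u1.
    have := taylor_cvg_riesz_profile s0 s1 ut1 => h.
    rewrite /riesz_eprofile ifF; last first.
      by apply/negbTE; apply: contraTneq ut1 => ->; rewrite normr1 ltxx.
    apply/esym/cvg_lim => //; apply: cvg_EFin; first by apply: nearW.
    by apply: cvgD; [exact: h|exact: cvg_cst].
have H : (\int[mu]_(x in `[0%R, (2 * pi)%R]) (g n x)%:E)%E @[n --> \oo] -->
   (\int[mu]_(t in `[0%R, (2 * pi)%R]) (riesz_eprofile s (u t) + C%:E))%E.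
  rewrite limE; apply: cvg_monotone_convergence => //.
  - by move=> n x _; rewrite lee_fin.
  - by move=> x _ m n mn; rewrite lee_fin gnd.
have fin : ((2 * pi)^-1 : R)%:E \is a fin_num by [].
have := cvgeZl fin H; apply: cvg_trans.
apply: near_eq_cvg; apply: nearW => m.
by rewrite -gE -circle_emean_fin.
Qed.

(** On this set every u^(2n) equals 1, so its measure is at most 2 pi times
    the moment of order 2n, which tends to 0. *)
Lemma motion_negligible m u v : circular_motion m u v ->
  mu.-negligible (`[0, 2 * pi] `&` [set t | `|u t| = 1]).
Proof.
move=> muv; have [cu _] := circular_motion_continuous muv.
have mE : measurable (`[0, 2 * pi] `&` [set t | `|u t| = 1] : set R).
  apply: measurableI => //.
  have -> : [set t | `|u t| = 1] = (fun t => `|u t|) @^-1` [set 1] by [].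
  rewrite -[X in measurable X]setTI.
  have mu1 : measurable_fun [set: R] (fun t => `|u t|).
    by apply: measurableT_comp => //; exact: continuous_measurable_fun.
  by apply: mu1.
apply/negligibleP => //.
set E := _ `&` _.
have bnd n : (mu E <= (2 * pi * bump_mass n)%:E)%E.
  have cX : continuous (fun t => u t ^+ n.*2) by exact: continuous_funX.
  have -> : (2 * pi * bump_mass n)%:E = (\int[mu]_(t in `[0%R,
    (2 * pi)%R]) (u t ^+ n.*2)%:E)%E.
    rewrite -(moment_double n).2 -(moment_circular_motion _ muv) /circle_mean.
    rewrite mulVKf ?gt_eqF ?lt0_2pi// /Rintegral fineK//.
    by apply: integrable_fin_num => //; exact: continuous_integrable02pi.
  rewrite -[mu E]mul1e -integral_cst//.
  have u0 t : 0 <= u t ^+ n.*2 by rewrite -muln2 mulnC exprM exprn_ge0// sqr_ge0.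
  apply: (@le_trans _ _ (\int[mu]_(t in E) (u t ^+ n.*2)%:E)%E); last first.
    apply: ge0_subset_integral => //.
    - by apply/measurable_EFinP; apply: measurable_funTS;
      exact: continuous_measurable_fun.
    - by move=> t _; rewrite lee_fin.
    - by move=> t [].
  apply: ge0_le_integral => //.
  - by apply/measurable_EFinP; apply: measurable_funTS;
    exact: continuous_measurable_fun.
  - move=> t [_ /= ut]; rewrite lee_fin -muln2 mulnC exprM -real_normK ?num_real//.
    by rewrite ut !expr1n.
suff E0 : mu E = 0%E by [].
apply/eqP; rewrite eq_le measure_ge0 andbT.
have fE : mu E \is a fin_num.
  rewrite ge0_fin_numE//; apply: le_lt_trans (bnd 0%N) _; exact: ltry.
rewrite -(fineK fE) lee_fin.
have H : 2 * pi * bump_mass n @[n --> \oo] --> (2 * pi * 0 : R).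
  by apply: cvgMr; exact: bump_mass_cvg0.
rewrite mulr0 in H; apply: (cvgr_to_ge H); apply: nearW => n.
by rewrite -lee_fin fineK.
Qed.

Lemma riesz_emean_motion s m u v C : 0 <= s -> s < 1 -> circular_motion m u v ->
  riesz_shift s <= C ->
  (taylor_mean (riesz_coef s) m.+1 + C)%:E @[m --> \oo] -->
    circle_emean (fun t => riesz_eprofile s (u t) + C%:E)%E.
Proof.
move=> s0 s1 muv CC; have [cu _] := circular_motion_continuous muv.
apply: riesz_emean_cvg => //.
- by move=> t; exact: circular_motion_norm_le1 muv.
- exact: motion_negligible muv.
- by move=> n; exact: moment_circular_motion muv.
Qed.

End ereal_mean.

(** * The continuous energy: finiteness, and its value at s = 0 *)

Section riesz_energy.
Context {R : realType}.

Lemma riesz_profile_continuous s (x : R) : x < 1 ->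
  {for x, continuous (riesz_profile s)}.
Proof.
move=> x1; have x0 : 0 < 2 * (1 - x) by lra.
have cB : {for x, continuous (fun y : R => 2 * (1 - y))}.
  by apply: cvgMr; apply: cvgB; [exact: cvg_cst|exact: cvg_id].
rewrite /riesz_profile; case: eqP => _.
  apply: cvgMl; apply: cvgN.
  by apply: (continuous_comp cB); exact: continuous_ln.
apply: (@continuous_comp _ _ _ _ (fun y => y `^ (- (s / 2))) x cB).
have [d _] := is_derive1_powR (- (s / 2)) x0.
exact/differentiable_continuous/derivable1_diffP.
Qed.

Lemma continuous_riesz_profile_comp s q (u : R -> R) : 0 <= q -> q < 1 ->
  continuous u -> (forall t, `|u t| <= 1) -> continuous (fun t =>
    riesz_profile s (q * u t)).
Proof.
move=> q0 q1 cu u1 t; apply: (@continuous_comp _ _ _ (fun t => q * u t)).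
  exact: (@continuous_funZ _ q _ cu).
apply: riesz_profile_continuous; apply: le_lt_trans (ler_norm _) _.
by rewrite normrM (ger0_norm q0); apply: le_lt_trans q1; rewrite ler_piMr.
Qed.

(** Both means are limits of the same sequence, since the truncations only see
    the moments of the motion. *)
Lemma riesz_mean_scaled s q m m' u v u' v' : 0 <= s -> s < 1 -> 0 <= q -> q < 1 ->
  circular_motion m u v -> circular_motion m' u' v' ->
  circle_mean (fun t => riesz_profile s (q * u t)) =
  circle_mean (fun t : R => riesz_profile s (q * u' t)).
Proof.
move=> s0 s1 q0 q1.
have H m0 (w w' : R -> R) : circular_motion m0 w w' ->
   (\sum_(n < m.+1.*2) riesz_coef s n * (q ^+ n * moment n) + riesz_shift s)%:E
     @[m --> \oo]
   --> (circle_mean (fun t => riesz_profile s (q * w t)) + riesz_shift s)%:E.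
  move=> mw; have [cw _] := circular_motion_continuous mw.
  have w1 t := circular_motion_norm_le1 t mw.
  have qw t : `|q * w t| < 1.
    by rewrite normrM (ger0_norm q0); apply: le_lt_trans q1; rewrite ler_piMr.
  have cc := continuous_riesz_profile_comp (s := s) q0 q1 cw w1.
  rewrite -[X in _ + X](circle_mean_cst (riesz_shift s)) -circle_meanD//;
    last exact: cst_continuous.
  rewrite -circle_emean_fin; last by apply: continuous_funD => //;
    exact: cst_continuous.
  have -> : (fun t => (riesz_profile s (q * w t) + riesz_shift s)%:E) =
     (fun t => riesz_eprofile s (q * w t) + (riesz_shift s)%:E)%E.
    apply/funext => t; rewrite /riesz_eprofile ifF//.
    by apply/negbTE; apply: contraTneq (qw t) => ->; rewrite normr1 ltxx.
  apply: (riesz_emean_cvg (u := fun t => q * w t) (c := fun n =>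
    q ^+ n * moment n)) => //.
  - exact: continuous_funZ.
  - by move=> t; exact: ltW.
  - rewrite (_ : _ `&` _ = set0); first exact: negligible_set0.
    by apply/seteqP; split => // t [_ /= h]; have := qw t; rewrite h ltxx.
  - move=> n; rewrite -(moment_circular_motion n mw) -circle_meanZ;
    last exact: continuous_funX.
    by apply: eq_circle_mean => t; rewrite exprMn.
move=> mu mu'; apply: (addIr (riesz_shift s)); apply: EFin_inj.
exact: (cvg_unique (@ereal_hausdorff R) (H _ _ _ mu) (H _ _ _ mu')).
Qed.

(** The limiting case q = 1 is |1 - z^2| = |1 - z| |1 + z| <= 2 min(|1 - z|,
    |1 + z|) at z = exp(i t), c = cos t: the kernel at z^2 is bounded below by
    the larger of the kernels at z and - z, up to the factor 2^(-s) or, at s =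
    0, the summand - ln 2. The smaller of these two is bounded above because
    |1 - z| or |1 + z| is at least sqrt 2. The requirement 1 < 2 la is 2^(1 -
    s) > 1, which is s < 1. *)
Lemma riesz_doubling s : 0 <= s -> s < 1 -> exists la ka : R, 1 < 2 * la /\
  forall q c : R, 0 <= q -> q < 1 -> `|c| <= 1 ->
    la * (riesz_profile s (q * c) + riesz_profile s (q * - c)) - ka
    <= riesz_profile s (q * (2 * c ^+ 2 - 1)).
Proof.
move=> s0 s1.
have geo (q c : R) : 0 <= q -> q < 1 -> `|c| <= 1 ->
  [/\ 0 < 2 * (1 - q * c), 0 < 2 * (1 - q * - c), 0 < 2 * (1 - q * (2 * c ^+ 2 - 1)),
   2 * (1 - q * (2 * c ^+ 2 - 1)) <= 4 * (2 * (1 - q * c)) &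
   2 * (1 - q * (2 * c ^+ 2 - 1)) <= 4 * (2 * (1 - q * - c))].
  move=> q0 q1; rewrite ler_norml => /andP[c0 c1].
  have h1 : 0 <= q * (1 - c) by rewrite mulr_ge0//; lra.
  have h2 : 0 <= q * (1 + c) by rewrite mulr_ge0//; lra.
  have h3 : 0 <= q * ((1 - c) * (1 + c)).
    by rewrite mulr_ge0// mulr_ge0//; lra.
  have h4 : 0 <= q * (1 - c) ^+ 2 by rewrite mulr_ge0// sqr_ge0.
  have h5 : 0 <= q * (1 + c) ^+ 2 by rewrite mulr_ge0// sqr_ge0.
  split; lra.
rewrite /riesz_profile; case: eqP => [_|/eqP s_neq0].
  (* s = 0: la = 1, and ka = ln 2 is the loss in |1 - z^2| <= 2 |1 - z| *)
  exists 1, (ln 2); split; first by lra.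
  move=> q c q0 q1 c1; have [hp hm h hhp hhm] := geo q c q0 q1 c1.
  have l4 : ln 4 = 2 * ln 2 :> R.
    rewrite (_ : 4 = 2 * 2 :> R); last by ring.
    by rewrite lnM ?posrE//; ring.
  have l2 : 0 <= ln 2 :> R by rewrite ln_ge0// ler1n.
  have ep : ln (2 * (1 - q * (2 * c ^+ 2 - 1))) <= 2 * ln 2 + ln (2 * (1 - q * c)).
    by rewrite -l4 -lnM ?posrE// ler_ln ?posrE// mulr_gt0.
  have em : ln (2 * (1 - q * (2 * c ^+ 2 - 1))) <= 2 * ln 2 + ln (2 * (1 - q * - c)).
    by rewrite -l4 -lnM ?posrE// ler_ln ?posrE// mulr_gt0.
  have [c0|c0] := leP 0 c.
    have : 0 <= ln (2 * (1 - q * - c)).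
      by rewrite ln_ge0//; have := mulr_ge0 q0 c0; lra.
    lra.
  have : 0 <= ln (2 * (1 - q * c)).
    have : 0 <= q * - c by rewrite mulr_ge0//; lra.
    by rewrite mulrN => h'; rewrite ln_ge0//; lra.
  lra.
have {}s0 : 0 < s by rewrite lt_def s_neq0.
set al := s / 2.
have al0 : 0 < al by rewrite /al divr_gt0.
pose la : R := 4 `^ (- al).
have la0 : 0 < la by rewrite powR_gt0.
exists la, la; split.
  have -> : la = 2 `^ (- s).
    rewrite /la (_ : 4 = 2 * 2 :> R); last by ring.
    rewrite powRM// -powRD; last by rewrite pnatr_eq0 implybT.
    by congr (_ `^ _); rewrite /al; field.
  rewrite -{1}(powRr1 (a := 2))// -powRD; last by rewrite pnatr_eq0 implybT.
  by rewrite /powR pnatr_eq0/= expR_gt1 mulr_gt0 ?ln_gt0 ?ltr1n//; lra.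
have anti (x y : R) : 0 < x -> x <= y -> y `^ (- al) <= x `^ (- al).
  move=> x0 xy; have y0 := lt_le_trans x0 xy.
  rewrite !powRN lef_pV2 ?posrE ?powR_gt0//.
  by apply: ge0_ler_powR => //; rewrite ?nnegrE ltW.
move=> q c q0 q1 c1; have [hp hm h hhp hhm] := geo q c q0 q1 c1.
have ep : la * (2 * (1 - q * c)) `^ (- al) <= (2 * (1 - q * (2 * c ^+ 2 - 1)))
  `^ (- al).
  by rewrite /la -powRM ?(ltW hp)//; exact: anti.
have em : la * (2 * (1 - q * - c)) `^ (- al) <=
  (2 * (1 - q * (2 * c ^+ 2 - 1))) `^ (- al).
  by rewrite /la -powRM ?(ltW hm)//; exact: anti.
have one (x : R) : 1 <= x -> la * x `^ (- al) <= la.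
  move=> x1; rewrite -[leRHS]mulr1 ler_pM2l//.
  by have := anti 1 x ltr01 x1; rewrite powR1.
rewrite mulrDr.
have [c0|c0] := leP 0 c.
  have : la * (2 * (1 - q * - c)) `^ (- al) <= la.
    by apply: one; have := mulr_ge0 q0 c0; lra.
  lra.
have : la * (2 * (1 - q * c)) `^ (- al) <= la.
  have : 0 <= q * - c by rewrite mulr_ge0//; lra.
  by rewrite mulrN => h'; apply: one; lra.
lra.
Qed.

(** The functions phi(q cos t), phi(- q cos t) and phi(q cos(2t)) have the
    same finite mean A_q for q < 1, so averaging [riesz_doubling] yields 2 la
    A_q - ka <= A_q, a bound that is uniform in q. It passes to the
    truncations at q = 1 by continuity. *)
Lemma taylor_mean_bounded s : 0 <= s -> s < 1 ->
  exists K, forall m, taylor_mean (riesz_coef s) m <= K :> R.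
Proof.
move=> s0 s1; have [la [ka [la1 H]]] := riesz_doubling s0 s1.
pose K : R := ka / (2 * la - 1).
have arith (A B D : R) : B = A -> D = A -> la * (A + B) - ka <= D -> A <= K.
  by move=> -> -> h; rewrite /K ler_pdivlMr; lra.
have AK q : 0 <= q -> q < 1 -> circle_mean (fun t => riesz_profile s (q * cos t)) <= K.
  move=> q0 q1.
  have mc := @cos_motion R; have mo := opp_motion mc; have md := @double_motion R.
  have c1 t := circular_motion_norm_le1 t mc.
  have co t := circular_motion_norm_le1 t mo.
  have cd t := circular_motion_norm_le1 t md.
  have [cc _] := circular_motion_continuous mc.
  have [cco _] := circular_motion_continuous mo.
  have [cdd _] := circular_motion_continuous md.
  have k1 := continuous_riesz_profile_comp (s := s) q0 q1 cc c1.
  have k2 := continuous_riesz_profile_comp (s := s) q0 q1 cco co.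
  have k3 := continuous_riesz_profile_comp (s := s) q0 q1 cdd cd.
  have E1 := riesz_mean_scaled s0 s1 q0 q1 mo mc.
  have E2 := riesz_mean_scaled s0 s1 q0 q1 md mc.
  have D := circle_mean_double k1 k2 k3 (fun t => H q (cos t) q0 q1 (c1 t)).
  exact: (arith _ _ _ E1 E2 D).
exists (Num.max K (taylor_mean (riesz_coef s) 0)) => -[|m];
  first by rewrite le_max lexx orbT.
rewrite le_max; apply/orP; left.
pose F q : R := \sum_(n < m.+1.*2) (riesz_coef s n * moment n) * q ^+ n.
have -> : taylor_mean (riesz_coef s) m.+1 = F 1.
  by apply: eq_bigr => n _; rewrite expr1n mulr1.
have cF : continuous F.
  apply: (@continuous_fun_sum _ m.+1.*2 (fun n q =>
    (riesz_coef s n * moment n) * q ^+ n)) => n.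
  by apply: continuous_funZ; exact: exprn_continuous.
have F1 : F q @[q --> 1^'-] --> F 1 by apply: cvg_at_left_filter; exact: cF.
apply: (cvgr_to_le F1); near=> q.
have q0 : 0 <= q by near: q; apply: nbhs_left_ge; exact: ltr01.
have q1 : q < 1 by near: q; exact: nbhs_left_lt.
apply: le_trans (AK q q0 q1).
have mc := @cos_motion R.
have c1 t := circular_motion_norm_le1 t mc.
have [cc _] := circular_motion_continuous mc.
have cq : continuous (fun t : R => q * cos t) by exact: continuous_funZ.
apply: (@le_trans _ _ (circle_mean (fun t => taylor (riesz_coef s) m.+1 (q * cos t)))).
  rewrite /taylor (@circle_mean_sum _ m.+1.*2 (fun n t =>
    riesz_coef s n * (q * cos t) ^+ n)).
    apply: ler_sum => n _; rewrite le_eqVlt; apply/orP; left; apply/eqP.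
    rewrite circle_meanZ; last exact: continuous_funX.
    rewrite (@eq_circle_mean _ _ (fun t => q ^+ n * cos t ^+ n)); last by move=>
      t; rewrite exprMn.
    rewrite circle_meanZ; last exact: continuous_funX.
    by rewrite (moment_circular_motion _ mc); ring.
  by move=> n; apply: continuous_funZ; exact: continuous_funX.
apply: le_circle_mean.
- exact: continuous_taylor.
- exact: continuous_riesz_profile_comp.
- move=> t; apply: taylor_le_riesz_profile => //; apply: le_lt_trans (ler_norm _) _.
  by rewrite normrM (ger0_norm q0); apply: le_lt_trans q1; rewrite ler_piMr.
Unshelve. all: by end_near. Qed.

Definition riesz_energy (s : R) : R :=
  limn (fun m => taylor_mean (riesz_coef s) m.+1).

Lemma taylor_mean_nondecr s m : 0 <= s -> s < 1 ->
  taylor_mean (riesz_coef s) m.+1 <= taylor_mean (riesz_coef s) m.+2 :> R.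
Proof.
move=> s0 s1; rewrite /taylor_mean [m.+2.*2]doubleS.
pose F n := riesz_coef s n * moment n.
have F0 n : 0 <= F n.+1.
  by apply: mulr_ge0; [exact/ltW/riesz_coef_gt0|exact: moment_ge0].
rewrite [leRHS](eq_bigr (fun n => F (nat_of_ord n)))// [leLHS](eq_bigr (fun n =>
  F (nat_of_ord n)))//.
move: F F0 => F F0.
by rewrite [leRHS]big_ord_recr [X in _ <= X + _]big_ord_recr/= -addrA lerDl;
  apply: addr_ge0; exact: F0.
Qed.

Lemma taylor_mean_cvg s : 0 <= s -> s < 1 ->
  taylor_mean (riesz_coef s) m.+1 @[m --> \oo] --> riesz_energy s.
Proof.
move=> s0 s1; have [K HK] := taylor_mean_bounded s0 s1.
have nd : {homo (fun m => taylor_mean (riesz_coef s) m.+1) :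
    m n / (m <= n)%N >-> m <= n}.
  move=> m n mn; rewrite -(subnKC mn).
  elim: (n - m)%N => [|k ih]; first by rewrite addn0.
  by apply: le_trans ih _; rewrite addnS taylor_mean_nondecr.
by apply: nondecreasing_is_cvgn => //; exists K => _ [m _ <-]; exact: HK.
Qed.

Lemma riesz_energy_profile s : 0 <= s -> s < 1 ->
  energy_profile (riesz_profile s) (riesz_coef s) (riesz_energy s).
Proof.
move=> s0 s1; split => //.
- by move=> n; exact: riesz_coef_gt0.
- by move=> m x _ x1; exact: taylor_le_riesz_profile.
- rewrite -(cvg_shiftS (fun m => taylor_mean (riesz_coef s) m)).
  exact: taylor_mean_cvg.
Qed.

Lemma riesz_emeanE s m u v C : 0 <= s -> s < 1 -> circular_motion m u v ->
  riesz_shift s <= C ->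
  circle_emean (fun t : R => riesz_eprofile s (u t) + C%:E)%E = (riesz_energy s + C)%:E.
Proof.
move=> s0 s1 muv CC; have cv := taylor_mean_cvg s0 s1.
apply: (cvg_unique (@ereal_hausdorff R) (riesz_emean_motion s0 s1 muv CC));
  apply: cvg_EFin.
  by apply: nearW.
by apply: cvgD; [exact: cv|exact: cvg_cst].
Qed.

(** At s = 0 the identity ln |1 - z^2| = ln |1 - z| + ln |1 + z| becomes,
    after integration, I = I + I. *)
Lemma riesz_energy0 : riesz_energy 0 = 0.
Proof.
pose C := riesz_shift (0 : R).
have C0 : 0 <= C by rewrite addr_ge0.
have mc := @cos_motion R; have mo := opp_motion mc; have md := @double_motion R.
have c1 t := circular_motion_norm_le1 t mc.
have s0 : 0 <= 0 :> R by [].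
have s1 : 0 < 1 :> R by [].
have E1 := riesz_emeanE s0 s1 mc (lexx C).
have E2 := riesz_emeanE s0 s1 mo (lexx C).
have CC : C <= C + C by rewrite lerDl.
have E3 := riesz_emeanE s0 s1 md CC.
have ge0 x : `|x| <= 1 -> (0 <= riesz_eprofile (0 : R) x + C%:E)%E.
  rewrite ler_norml => /andP[x0 x1].
  rewrite /riesz_eprofile; case: eqP => [_|/eqP xn1]; first by rewrite addye.
  rewrite -EFinD lee_fin; have := riesz_profile_ge s0 s1 x0.
  rewrite lt_neqAle xn1 x1 => /(_ isT); rewrite -/C; lra.
have me (u : R -> R) : continuous u -> measurable_fun [set: R] (fun t =>
  riesz_eprofile 0 (u t) + C%:E)%E.
  move=> cu; apply: emeasurable_funD => //.
  exact: measurableT_comp (measurable_riesz_eprofile 0) (continuous_measurable_fun cu).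
have [cc _] := circular_motion_continuous mc.
have [cco _] := circular_motion_continuous mo.
have E : circle_emean (fun t : R => riesz_eprofile 0 (2 * cos t ^+ 2 - 1) + (C +
  C)%:E)%E =
  (circle_emean (fun t : R => riesz_eprofile 0 (cos t) + C%:E) +
   circle_emean (fun t : R => riesz_eprofile 0 (- cos t) + C%:E))%E.
  rewrite /circle_emean -ge0_muleDr; last 2 first.
  - by apply: integral_ge0 => t _; exact: ge0.
  - by apply: integral_ge0 => t _; apply: ge0; rewrite normrN.
  congr (_ * _)%E; rewrite -ge0_integralD//; last 4 first.
  - by move=> t _; exact: ge0.
  - by apply: measurable_funTS; exact: me.
  - by move=> t _; apply: ge0; rewrite normrN.
  - by apply: measurable_funTS; exact: me.
  apply: eq_integral => t _; rewrite /riesz_eprofile.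
  move: (cos t) (c1 t) => c; rewrite ler_norml => /andP[c0' c1'].
  have [->|cn1] := eqVneq c 1.
    have -> : 2 * 1 ^+ 2 - 1 == 1 :> R by rewrite expr1n mulr1 -natr1 addrK.
    by rewrite ifF// lt_eqF//; lra.
  have [cm1|cn2] := eqVneq (- c) 1.
    have -> : c = -1 by rewrite -cm1 opprK.
    have -> : 2 * (-1) ^+ 2 - 1 == 1 :> R by rewrite sqrrN expr1n mulr1 -natr1 addrK.
    by [].
  (* away from the two singularities: 2 (1 - cos 2t) = 2 (1 - c) 2 (1 + c) *)
  have {}cn1 : 0 < 1 - c by rewrite subr_gt0 lt_neqAle cn1.
  have {}cn2 : 0 < 1 - - c by rewrite subr_gt0 lt_neqAle cn2 lerNl.
  rewrite ifF; last first.
    apply/negbTE; rewrite lt_eqF//; have := mulr_gt0 cn1 cn2; lra.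
  rewrite -!EFinD /riesz_profile eqxx; congr (_%:E).
  have -> : 2 * (1 - (2 * c ^+ 2 - 1)) = 2 * (1 - c) * (2 * (1 - - c)) by ring.
  by rewrite lnM ?posrE ?mulr_gt0//; ring.
rewrite E1 E2 E3 -EFinD in E; have := EFin_inj E; lra.
Qed.

End riesz_energy.

(** * The kernel and the circle in the complex plane *)

Section complex_plane.
Context {R : realType}.

Lemma continuous_Re : continuous (@complex.Re R : R[i]^o -> R).
Proof.
move=> z; apply/(@cvgrPdist_lt R R _ (nbhs (z : R[i]^o)) _) => e e0.
have e0' : 0 < e%:C :> R[i] by rewrite ltcR.
near=> t.
have zt : `|z - t| < e%:C.
  by near: t; exact: (@nbhsx_ballx _ R[i]^o z _ e0').
rewrite -ltcR; apply: le_lt_trans zt.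
by have := normc_ge_Re (z - t); rewrite !raddfB.
Unshelve. all: by end_near. Qed.

Lemma normc_ge_Im (z : R[i]) : `|complex.Im z|%:C <= `|z|.
Proof.
rewrite normc_def lecR -sqrtr_sqr ler_wsqrtr// lerDr; exact: sqr_ge0.
Qed.

Lemma continuous_Im : continuous (@complex.Im R : R[i]^o -> R).
Proof.
move=> z; apply/(@cvgrPdist_lt R R _ (nbhs (z : R[i]^o)) _) => e e0.
have e0' : 0 < e%:C :> R[i] by rewrite ltcR.
near=> t.
have zt : `|z - t| < e%:C.
  by near: t; exact: (@nbhsx_ballx _ R[i]^o z _ e0').
rewrite -ltcR; apply: le_lt_trans zt.
by have := normc_ge_Im (z - t); rewrite !raddfB.
Unshelve. all: by end_near. Qed.

Lemma continuous_dot_plane (z : R[i]) : continuous (dot z : R[i]^o -> R).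
Proof.
by move=> w; apply: (cvgD (cvgM (cvg_cst _) (@continuous_Re w)) (cvgM (cvg_cst
  _) (@continuous_Im w))).
Qed.

Lemma unit_circle_closed : closed (@unit_circle R).
Proof.
have -> : @unit_circle R = (fun z : R[i]^o => dot z z) @^-1` [set x | x = 1].
  apply/seteqP; split => z; first exact: dotzz.
  by move=> /= dz; apply/unit_circleE; rewrite -dz /dot; ring.
apply: preimage_closed; last exact: closed_eq.
move=> z _.
exact: (cvgD (cvgM (@continuous_Re z) (@continuous_Re z)) (cvgM (@continuous_Im
  z) (@continuous_Im z))).
Qed.

Lemma measurable_unit_circle : measurable (@unit_circle R : set (Borel_complex R)).
Proof.
rewrite -[X in measurable X]setCK; apply: measurableC.
by apply: sub_sigma_algebra; rewrite openC; exact: unit_circle_closed.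
Qed.

Lemma within_circle_measurable (f : R[i]^o -> R) :
  {within @unit_circle R, continuous f} ->
  measurable_fun (@unit_circle R : set (Borel_complex R)) (f : Borel_complex R -> R).
Proof.
move=> /continuousP cf; apply: (measurability _ (RGenOpens.measurableE R)).
move=> _ [_ [a [b ->] <-]].
have /open_subspaceP[V oV VE] := cf _ (@interval_open R (BRight a) (BLeft b) isT isT).
rewrite setIC -VE; apply: measurableI; last exact: measurable_unit_circle.
by apply: sub_sigma_algebra.
Qed.

Lemma normc_subE (z w : R[i]) : unit_circle z -> unit_circle w ->
  Normc.normc (z - w) = Num.sqrt (2 * (1 - dot z w)).
Proof.
case: z w => [a b] [c d] /unit_circleE/= ab /unit_circleE/= cd.
congr Num.sqrt; rewrite /dot/=.
transitivity ((a ^+ 2 + b ^+ 2) + (c ^+ 2 + d ^+ 2) - 2 * (a * c + b * d));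
  first by ring.
by rewrite ab cd; ring.
Qed.

Lemma dot_eq1 (z w : R[i]) : unit_circle z -> unit_circle w ->
  (dot z w == 1) = (z == w).
Proof.
move=> uz uw; apply/eqP/eqP => [d1|<-]; last exact: dotzz.
apply/eqP; rewrite -subr_eq0; apply/eqP/Normc.eq0_normc.
by rewrite normc_subE// d1 subrr mulr0 sqrtr0.
Qed.

Lemma dot_lt1 (z w : R[i]) : unit_circle z -> unit_circle w -> z != w ->
  dot z w < 1.
Proof.
move=> uz uw zw; have := dot_norm_le1 uz uw; rewrite ler_norml => /andP[_ d1].
by rewrite lt_neqAle d1 dot_eq1// zw.
Qed.

Lemma riesz_kernelE s (z w : R[i]) : unit_circle z -> unit_circle w ->
  riesz_kernel s z w = riesz_eprofile s (dot z w).
Proof.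
move=> uz uw; rewrite /riesz_kernel /riesz_eprofile dot_eq1//.
case: ifPn => // zw.
have d0 : 0 < 2 * (1 - dot z w) by rewrite mulr_gt0// subr_gt0 dot_lt1.
rewrite normc_subE// -powR12_sqrt ?(ltW d0)// /riesz_profile; case: ifP => _;
  congr (_%:E).
  rewrite div1r lnV ?posrE ?powR_gt0// ln_powR; ring.
by rewrite -powRrM; congr (_ `^ _); ring.
Qed.

(** Needed to carry compactness from an interval to the circle. *)
Lemma circle_pt_onto (z : R[i]) : unit_circle z ->
  exists2 t, t \in `[0, 2 * pi] & z = circle_pt t.
Proof.
case: z => x y /unit_circleE /= xy.
have x1 : -1 <= x <= 1.
  rewrite -ler_norml -(@ler_pXn2r _ 2)// ?nnegrE// real_normK ?num_real// expr1n -xy.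
  by rewrite lerDl sqr_ge0.
have [a0 api] := (acos_ge0 x1, acos_lepi x1).
have cx : cos (acos x) = x by apply: acosK; rewrite in_itv.
have sx : sin (acos x) = `|y|.
  rewrite -sqrtr_sqr sin_acos//; congr Num.sqrt; lra.
have [y0|y0] := leP 0 y.
  exists (acos x); first by rewrite in_itv/= a0/=; have := pi_ge0 R; lra.
  by rewrite /circle_pt cx sx ger0_norm.
exists (2 * pi - acos x); first by rewrite in_itv/=; apply/andP; split; lra.
rewrite /circle_pt cosB sinB (mulr_natl pi) cos2pi sin2pi cx sx ltr0_norm//.
by congr (_ +i* _); ring.
Qed.

End complex_plane.

(** * Integrals against arc length *)

Section arc_integrals.
Context {R : realType}.
Local Notation C := (Borel_complex R).
Local Notation S1 := (@unit_circle R : set C).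

(** Reduces the integral of a function bounded below by - c, against a measure
    of mass 1, to that of a nonnegative function. *)
Lemma integral_shift (m : {measure set C -> \bar R}) (F : C -> \bar R) (c x : R) :
  m S1 = 1%E -> measurable_fun S1 F -> (forall z, S1 z -> (0 <= F z + c%:E)%E) ->
  (\int[m]_(z in S1) (F z + c%:E) = x%:E)%E ->
  (\int[m]_(z in S1) F z = (x - c)%:E)%E.
Proof.
move=> m1 mF F0 E; have mS := @measurable_unit_circle R.
have mFc : measurable_fun S1 (fun z => F z + c%:E)%E.
  by apply: emeasurable_funD => //; exact: measurable_cst.
have iF : m.-integrable S1 (fun z => F z + c%:E)%E.
  apply/integrableP; split => //.
  rewrite (eq_integral (fun z => F z + c%:E)%E); last first.
    by move=> z /[!inE] zS; rewrite gee0_abs// F0.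
  by rewrite E ltry.
have ic : m.-integrable S1 (cst c%:E).
  apply/integrableP; split; first exact: measurable_cst.
  by rewrite integral_cst// m1 mule1 ltry.
transitivity (\int[m]_(z in S1) ((fun z => F z + c%:E) \- cst c%:E) z)%E.
  by apply: eq_integral => z _ /=; rewrite addeK.
by rewrite integralB// E integral_cst// m1 mule1 EFinB.
Qed.

Lemma arc_measure_circle : @arc_measure R S1 = 1%E.
Proof.
rewrite /arc_measure /distribution /= /pushforward.
rewrite (_ : _ @^-1` _ = setT) ?probability_setT//.
by apply/seteqP; split => // t _; exact: circle_pt_unit.
Qed.

Lemma arc_integral_ge0 (F : C -> \bar R) : measurable_fun S1 F ->
  (forall z, S1 z -> (0 <= F z)%E) ->
  (\int[@arc_measure R]_(z in S1) F z)%E = circle_emean (fun t => F (circle_pt t)).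
Proof.
move=> mF F0; rewrite /arc_measure /distribution.
rewrite ge0_integral_pushforward//=; last 2 first.
- exact: measurable_unit_circle.
- by move=> z /[!inE]; exact: F0.
have -> : @expi R @^-1` S1 = setT.
  by apply/seteqP; split => // t _; exact: circle_pt_unit.
rewrite integral_uniform.
- by rewrite subr0.
- apply: (measurable_comp (@measurable_unit_circle R) _ mF);
  last exact: measurable_expi.
  by move=> _ [t _ <-]; exact: circle_pt_unit.
- by move=> t; apply: F0; exact: circle_pt_unit.
Qed.

Lemma kernel_measurable s z : unit_circle z ->
  measurable_fun S1 (fun w : C => riesz_kernel s z w).
Proof.
move=> uz.
apply/(@measurable_fun_eqP _ _ _ _ S1 (fun w : C => riesz_eprofile s (dot z w))).
  by move=> w /[!inE] uw; rewrite riesz_kernelE.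
apply: (measurable_comp measurableT) => //; first exact: measurable_riesz_eprofile.
apply: within_circle_measurable; apply: continuous_subspaceT;
  exact: continuous_dot_plane.
Qed.

Lemma riesz_kernel_ge (s : R) (z w : R[i]) : 0 <= s -> s < 1 -> unit_circle z ->
  unit_circle w ->
  (0 <= riesz_kernel s z w + (riesz_shift s)%:E)%E.
Proof.
move=> s0 s1 uz uw; rewrite riesz_kernelE// /riesz_eprofile.
have := dot_norm_le1 uz uw; rewrite ler_norml => /andP[d0 d1].
case: eqP => [_|/eqP dn1]; first by rewrite addye.
rewrite -EFinD lee_fin; have := @riesz_profile_ge _ s _ s0 s1 d0.
by rewrite lt_neqAle dn1 d1 => /(_ isT); lra.
Qed.

Lemma kernel_emean (s : R) (z : R[i]) : 0 <= s -> s < 1 -> unit_circle z ->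
  circle_emean (fun t => riesz_kernel s z (circle_pt t) + (riesz_shift s)%:E)%E
  = (riesz_energy s + riesz_shift s)%:E.
Proof.
move=> s0 s1 uz; have [v zv] := dot_motion uz.
rewrite -(riesz_emeanE s0 s1 zv (lexx _)); congr circle_emean.
by apply/funext => t; rewrite riesz_kernelE//; exact: circle_pt_unit.
Qed.

(** Arc length has constant potential on the circle: z only enters as the
    phase of a circular motion. *)
Lemma arc_kernel (s : R) (z : R[i]) : 0 <= s -> s < 1 -> unit_circle z ->
  (\int[@arc_measure R]_(w in S1) riesz_kernel s z w = (riesz_energy s)%:E)%E.
Proof.
move=> s0 s1 uz.
rewrite (@integral_shift _ _ (riesz_shift s) (riesz_energy s + riesz_shift s)) ?addrK//.
- exact: arc_measure_circle.
- exact: kernel_measurable.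
- by move=> w uw; exact: riesz_kernel_ge.
rewrite arc_integral_ge0.
- exact: kernel_emean.
- apply: emeasurable_funD; [exact: kernel_measurable|exact: measurable_cst].
- by move=> w uw; exact: riesz_kernel_ge.
Qed.

Lemma arc_energyE (s : R) : 0 <= s -> s < 1 -> arc_energy s = (riesz_energy s)%:E.
Proof.
move=> s0 s1; rewrite /arc_energy.
rewrite (eq_integral (cst (riesz_energy s)%:E)); last first.
  by move=> z /[!inE] uz; exact: arc_kernel.
rewrite integral_cst; last exact: measurable_unit_circle.
by rewrite -[RHS]mule1; congr (_ * _)%E; exact: arc_measure_circle.
Qed.

End arc_integrals.

(** * Greedy sequences *)

Section greedy.
Context {R : realType}.
Variables (s : R) (p : nat) (a : nat -> R[i]).
Hypotheses (s0 : 0 <= s) (s1 : s < 1).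
Hypothesis greedy : greedy_energy_sequence s p a.

Lemma greedy_unit n : unit_circle (a n).
Proof. by case: greedy. Qed.

Lemma kernel_neqNy z w : unit_circle z -> unit_circle w -> riesz_kernel s z w != -oo%E.
Proof. by move=> uz uw; rewrite /riesz_kernel; case: (z == w) => //; case: (s ==
  0). Qed.

Lemma kernel_shift_measurable w : unit_circle w ->
  measurable_fun [set: R] (fun t => riesz_kernel s w (circle_pt t) +
    (riesz_shift s)%:E)%E.
Proof.
move=> uw; apply: emeasurable_funD; last exact: measurable_cst.
apply: (measurable_comp (@measurable_unit_circle R) _ (kernel_measurable s uw)).
  by move=> _ [t _ <-]; exact: circle_pt_unit.
exact: measurable_expi.
Qed.

Lemma circle_emean_potential n :
  circle_emean (fun t => \sum_(k < n) (riesz_kernel s (a k) (circle_pt t) +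
    (riesz_shift s)%:E))%E
  = (n%:R * (riesz_energy s + riesz_shift s))%:E.
Proof.
rewrite /circle_emean ge0_integral_sum//.
- rewrite ge0_sume_distrr; last first.
    move=> k _; apply: integral_ge0 => t _; apply: riesz_kernel_ge => //.
      exact: greedy_unit.
    exact: circle_pt_unit.
  rewrite (eq_bigr (fun=> (riesz_energy s + riesz_shift s)%:E)).
    by rewrite sumEFin sumr_const card_ord -[_ *+ n]mulr_natl.
  by move=> k _; apply: kernel_emean => //; exact: greedy_unit.
- by move=> k; apply: measurable_funTS; apply: kernel_shift_measurable;
  exact: greedy_unit.
- move=> k t _; apply: riesz_kernel_ge => //; first exact: greedy_unit.
  exact: circle_pt_unit.
Qed.

Lemma kernelC z w : unit_circle z -> unit_circle w -> riesz_kernel s z w =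
  riesz_kernel s w z.
Proof. by move=> uz uw; rewrite !riesz_kernelE// dotC. Qed.

Lemma potential_shift n z : unit_circle z ->
  (potential s a n z + (n%:R * riesz_shift s)%:E =
  \sum_(k < n) (riesz_kernel s (a k) z + (riesz_shift s)%:E))%E.
Proof.
move=> uz; rewrite /potential big_split/= sumEFin sumr_const card_ord
  -(mulr_natl (riesz_shift s) n).
by congr (_ + _)%E; apply: eq_bigr => k _; rewrite kernelC//; exact: greedy_unit.
Qed.

(** The greedy choice attains the infimum of the potential over the circle,
    which is at most its mean; by [arc_kernel] each of the n points
    contributes the same amount to this mean. *)
Lemma greedy_potential_le n : (p < n)%N ->
  (potential s a n (a n) <= (n%:R * riesz_energy s)%:E)%E.
Proof.
move=> pn; set v := potential s a n (a n).
suff : (v + (n%:R * riesz_shift s)%:E <= (n%:R * (riesz_energy s + riesz_shift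
  s))%:E)%E.
  by rewrite [X in (_ <= X%:E)%E -> _]mulrDr EFinD leeD2rE.
have v0 : (0 <= v + (n%:R * riesz_shift s)%:E)%E.
  rewrite potential_shift; last exact: greedy_unit.
  by apply: sume_ge0 => k _; apply: riesz_kernel_ge => //; exact: greedy_unit.
have vle t : (v + (n%:R * riesz_shift s)%:E <=
    \sum_(k < n) (riesz_kernel s (a k) (circle_pt t) + (riesz_shift s)%:E))%E.
  rewrite -potential_shift; last exact: circle_pt_unit.
  rewrite leeD2r// /v; case: greedy => _ _ ->//.
  by apply: ereal_inf_lbound; exists (circle_pt t) => //; exact: circle_pt_unit.
rewrite -circle_emean_potential.
have -> : (v + (n%:R * riesz_shift s)%:E)%E =
    circle_emean (fun=> v + (n%:R * riesz_shift s)%:E)%E.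
  rewrite /circle_emean integral_cst//.
  have E : lebesgue_measure (`[0, 2 * pi]%classic : set R) = (2 * pi)%:E :> \bar R.
    by rewrite lebesgue_measure_itv/= lte_fin (lt0_2pi R) -EFinB subr0.
  rewrite [X in (_ * (_ * X))%E]E.
  rewrite muleCA -EFinM mulVf ?mule1//.
  by rewrite gt_eqF// lt0_2pi.
rewrite /circle_emean lee_pmul2l//; last by rewrite lte_fin invr_gt0 lt0_2pi.
apply: ge0_le_integral => //.
- apply: measurable_funTS; apply: emeasurable_fun_sum => k.
  by apply: kernel_shift_measurable; exact: greedy_unit.
Qed.

(** Initial points are distinct by hypothesis; a later point repeating an
    earlier one would have infinite potential, against [greedy_potential_le].
    *)
Lemma greedy_neq i j : (j < i)%N -> a i != a j.
Proof.
move=> ji; have [ip|pi] := leqP i p.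
  apply/eqP => aij; case: greedy => _ /(_ i j ip (ltnW (leq_trans ji ip)) aij) ij _.
  by rewrite ij ltnn in ji.
have := greedy_potential_le pi; apply: contraTneq => aij.
have -> : potential s a i (a i) = +oo%E.
  apply/esum_eqyP; first by move=> k _; exact: kernel_neqNy (greedy_unit _)
    (greedy_unit _).
  exists (Ordinal ji); split => //; last by rewrite /riesz_kernel aij eqxx.
by rewrite -ltNge ltry.
Qed.

Lemma greedy_dot_lt1 i j : i != j -> dot (a i) (a j) < 1.
Proof.
move=> ij; apply: dot_lt1; [exact: greedy_unit|exact: greedy_unit|].
by move: ij; rewrite neq_ltn => /orP[] h; [rewrite eq_sym|]; exact: greedy_neq.
Qed.

Lemma greedy_kernel i j : i != j ->
  riesz_kernel s (a i) (a j) = (riesz_profile s (dot (a i) (a j)))%:E.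
Proof.
move=> ij; rewrite riesz_kernelE; try exact: greedy_unit.
by rewrite /riesz_eprofile lt_eqF// greedy_dot_lt1.
Qed.

Lemma greedy_potentialE n :
  potential s a n (a n) = (next_potential (riesz_profile s) a n)%:E.
Proof.
rewrite /potential /next_potential -sumEFin; apply: eq_bigr => k _.
by rewrite greedy_kernel// gtn_eqF.
Qed.

Lemma greedy_energyE n :
  discrete_energy s a n = (real_energy (riesz_profile s) a n)%:E.
Proof.
rewrite /discrete_energy /real_energy -sumEFin; apply: eq_bigr => i _.
by rewrite -sumEFin; apply: eq_bigr => j ij; rewrite greedy_kernel.
Qed.

Lemma greedy_next_potential_le n : (p < n)%N ->
  next_potential (riesz_profile s) a n <= n%:R * riesz_energy s.
Proof. by move=> pn; rewrite -lee_fin -greedy_potentialE;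
  exact: greedy_potential_le. Qed.

Lemma greedy_energy_cvg :
  (fun N => discrete_energy s a N / ((N%:R : R) ^+ 2)%:E)%E @ \oo -->
    (riesz_energy s)%:E.
Proof.
have H := real_energy_cvg (riesz_energy_profile s0 s1) greedy_unit
  greedy_dot_lt1 greedy_next_potential_le.
have : (real_energy (riesz_profile s) a N / N%:R ^+ 2)%:E @[N --> \oo] -->
  (riesz_energy s)%:E.
  by apply: cvg_EFin; [exact: nearW|exact: H].
apply: cvg_trans; apply: near_eq_cvg; near=> N.
have N0 : (0 < N)%N by near: N; exists 1%N.
by rewrite greedy_energyE inver sqrf_eq0 pnatr_eq0 -[N == 0%N]negbK -lt0n N0 EFinM.
Unshelve. all: by end_near. Qed.

Lemma greedy_potential_cvg :
  (fun N => potential s a N (a N) / (N%:R : R)%:E)%E @ \oo --> (riesz_energy s)%:E.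
Proof.
have H := next_potential_cvg (riesz_energy_profile s0 s1) greedy_unit
  greedy_dot_lt1 greedy_next_potential_le.
have : (next_potential (riesz_profile s) a N / N%:R)%:E @[N --> \oo] -->
  (riesz_energy s)%:E.
  by apply: cvg_EFin; [exact: nearW|exact: H].
apply: cvg_trans; apply: near_eq_cvg; near=> N.
have N0 : (0 < N)%N by near: N; exists 1%N.
by rewrite greedy_potentialE inver pnatr_eq0 -[N == 0%N]negbK -lt0n N0 EFinM.
Unshelve. all: by end_near. Qed.

End greedy.

(** * Korovkin approximation *)

Section korovkin.
Context {R : realType}.
Variable f : R[i]^o -> R.
Hypothesis cf : {within @unit_circle R, continuous f}.

Lemma continuous_on_circle : continuous (fun t => f (circle_pt t)).
Proof.
move=> t; have /subspace_continuousP cf' := cf.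
have := cf' (circle_pt t) (circle_pt_unit t).
move=> H U /H /=; rewrite /within/= => {}H.
have := @continuous_expi R t _ H.
apply: (@filterS _ (nbhs t) _ (fun u => unit_circle (circle_pt u) ->
  U (f (circle_pt u)))) => //.
by move=> u; apply; exact: circle_pt_unit.
Qed.

(** By compactness of the square of angles it suffices to find C locally: near
    a pair with |f z - f w| < e any C >= 0 works, and near any other pair 1 -
    <z, w> is bounded away from 0. *)
Lemma korovkin_modulus (e : R) : 0 < e -> exists2 C, 0 <= C &
  forall z w, unit_circle z -> unit_circle w ->
    `|f z - f w| <= e + C * (1 - dot z w).
Proof.
move=> e0.
pose g t := f (circle_pt t).
have cg : continuous g by exact: continuous_on_circle.
pose h (x : R * R) := `|g x.1 - g x.2|.
pose d (x : R * R) := 1 - dot (circle_pt x.1) (circle_pt x.2).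
have ch : continuous h.
  move=> x; apply: cvg_norm; apply: cvgB.
    by apply: (@continuous_comp _ _ _ fst g); [apply: cvg_fst|exact: cg].
  by apply: (@continuous_comp _ _ _ snd g); [apply: cvg_snd|exact: cg].
have cd : continuous d.
  have c1 : continuous (fun x : R * R => cos x.1).
    by move=> x; apply: (@continuous_comp _ _ _ fst (@cos R));
      [apply: cvg_fst|exact: continuous_cos].
  have c2 : continuous (fun x : R * R => cos x.2).
    by move=> x; apply: (@continuous_comp _ _ _ snd (@cos R));
      [apply: cvg_snd|exact: continuous_cos].
  have c3 : continuous (fun x : R * R => sin x.1).
    by move=> x; apply: (@continuous_comp _ _ _ fst (@sin R));
      [apply: cvg_fst|exact: continuous_sin].
  have c4 : continuous (fun x : R * R => sin x.2).
    by move=> x; apply: (@continuous_comp _ _ _ snd (@sin R));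
      [apply: cvg_snd|exact: continuous_sin].
  move=> x; apply: cvgB; first exact: cvg_cst.
  by apply: cvgD; apply: cvgM; [exact: c1|exact: c2|exact: c3|exact: c4].
have d0 x : 0 <= d x.
  have := dot_norm_le1 (circle_pt_unit x.1) (circle_pt_unit x.2).
  by rewrite ler_norml /d => /andP[_]; lra.
have dh x : d x = 0 -> h x = 0.
  move=> /eqP; rewrite subr_eq0 eq_sym dot_eq1; try exact: circle_pt_unit.
  by move=> /eqP E; rewrite /h /g E subrr normr0.
have cK := compact_setX (@segment_compact R 0 (2 * pi)) (@segment_compact R 0 (2 * pi)).
have /compact_near_coveringP nK := cK.
have /nK H : forall x, (`[0, 2 * pi] `*` `[0, 2 * pi])%classic x ->
    \forall x' \near x & C \near (+oo : set_system R), h x' <= e + C * d x'.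
  move=> x _.
  have [hx|hx] := ltP (h x) e.
    have A : \forall x' \near x, h x' < e by exact: (cvgr_lt (h x) (ch x) _ hx).
    have B : \forall C \near (+oo : set_system R), 0 <=
      C by exact: nbhs_pinfty_ge (num_real _).
    exists ([set x' | h x' < e], [set C | 0 <= C]); first by split.
    move=> [x' C] [/= hx' C0]; apply: le_trans (ltW hx') _.
    by rewrite lerDl mulr_ge0.
  have dx : 0 < d x.
    rewrite lt_neqAle d0 andbT eq_sym; apply/eqP => /dh hx0.
    by rewrite hx0 leNgt e0 in hx.
  have A : \forall x' \near x, h x' < h x + 1.
    by apply: (cvgr_lt (h x) (ch x)); rewrite ltrDl.
  have A' : \forall x' \near x, d x / 2 < d x'.
    by apply: (cvgr_gt (d x) (cd x)); lra.
  have B : \forall C \near (+oo : set_system R), (h x + 1) / (d x / 2) <= C.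
    by exact: nbhs_pinfty_ge (num_real _).
  exists ([set x' | h x' < h x + 1] `&` [set x' | d x / 2 < d x'],
    [set C | (h x + 1) / (d x / 2) <= C]).
    by split => //; exact: filterI.
  move=> [x' C] [[/= h1 h2]]; rewrite ler_pdivrMr; last by lra.
  move=> h3.
  have hx1 : 0 < h x + 1 by rewrite ltr_wpDl// normr_ge0.
  have C0 : 0 <= C.
    have : 0 <= C * (d x / 2) by exact: ltW (lt_le_trans hx1 h3).
    by rewrite pmulr_lge0//; exact: divr_gt0.
  apply: le_trans (ltW h1) _; apply: le_trans h3 _.
  by have := ler_wpM2l C0 (ltW h2); lra.
have B : \forall C \near (+oo : set_system R), 0 <=
  C by exact: nbhs_pinfty_ge (num_real _).
have [C [C0 HC]] := filter_ex (filterI B H).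
exists C => // z w /circle_pt_onto[t tI ->] /circle_pt_onto[t' tI' ->].
exact: (HC (t, t')).
Qed.

(** Compare with the value at one point by means of [korovkin_modulus]. *)
Lemma circle_bounded : exists2 B, 0 <= B & forall z, unit_circle z -> `|f z| <= B.
Proof.
have [C C0 HC] := korovkin_modulus ltr01.
exists (`|f (circle_pt 0)| + (1 + C * 2)); first by rewrite addr_ge0//
  addr_ge0// mulr_ge0.
move=> z uz; have H := HC _ _ uz (circle_pt_unit 0).
have /ler_normlW D := dot_norm_le1 uz (circle_pt_unit 0).
have /andP[D' _] : -1 <= dot z (circle_pt 0) <=
  1 by rewrite -ler_norml dot_norm_le1//; exact: circle_pt_unit.
rewrite -[f z](subrK (f (circle_pt 0))) addrC; apply: le_trans (ler_normD _ _) _.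
rewrite lerD2l; apply: le_trans H _; rewrite lerD2l ler_wpM2l//; lra.
Qed.

(** Korovkin argument. Let T z be the mean of f against the density peaked at
    z. Then |T z - f z| is at most e/4 + C/(n+1), by [korovkin_modulus] and
    [circle_mean_bump_spread]. Exchanging sum and mean, the average of T over
    the points is the mean of f(exp(i t)) times the average of a polynomial in
    <exp(i t), a_k>, and that average tends to 1 uniformly in t. *)
Lemma uniform_distribution (a : nat -> R[i]) : (forall k, unit_circle (a k)) ->
  (forall (c : nat -> R) M (e : R), 0 < e ->
    \forall N \near \oo, forall z, unit_circle z ->
     `|N%:R^-1 * (\sum_(k < N) \sum_(n < M) c n * dot z (a k) ^+ n) -
       \sum_(n < M) c n * moment n| < e) ->
  N%:R^-1 * \sum_(k < N) f (a k) @[N --> \oo] --> circle_mean (fun t =>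
    f (circle_pt t)).
Proof.
move=> ua Hpoly.
pose g t := f (circle_pt t).
have cg : continuous g by exact: continuous_on_circle.
have [B B0 HB] := circle_bounded.
apply/cvgrPdist_lt => e e0.
have e4 : 0 < e / 4 by rewrite divr_gt0.
have [C C0 HC] := korovkin_modulus e4.
have [n Cn] : exists n : nat, C / n.+1%:R < e / 4.
  have [m _ Hm] := near_div_natr_lt C e4.
  by exists m; apply: Hm => /=.
pose T z := circle_mean (fun t => g t * circle_bump n (dot z (circle_pt t))).
have cbump (z : R[i]) : continuous (fun t => circle_bump n (dot z (circle_pt t))).
  by apply: continuous_circle_bump; exact: continuous_dot_circle_pt.
have Tf z : unit_circle z -> `|T z - f z| <= e / 2.
  move=> uz; have [v zv] := dot_motion uz.
  have -> : T z - f z = circle_mean (fun t => (g t - f z) * circle_bump n (dot z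
    (circle_pt t))).
    rewrite (@eq_circle_mean _ _ (fun t => g t * circle_bump n (dot z (circle_pt t)) +
       - f z * circle_bump n (dot z (circle_pt t)))); last by move=> t;
         rewrite mulrBl mulNr.
    rewrite circle_meanD; last 2 first.
    - exact: continuous_funM.
    - exact: continuous_funZ.
    by rewrite circle_meanZ// (circle_mean_bump n zv) mulr1.
  have cF : continuous (fun t => (1 - dot z (circle_pt t)) * circle_bump n (dot
    z (circle_pt t))).
    apply: continuous_funM => // t; apply: cvgB;
      [exact: cvg_cst|exact: continuous_dot_circle_pt].
  apply: (@le_trans _ _ (circle_mean (fun t =>
    e / 4 * circle_bump n (dot z (circle_pt t)) +
      C * ((1 - dot z (circle_pt t)) * circle_bump n (dot z (circle_pt t)))))).
    apply: circle_mean_abs_le.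
    - apply: continuous_funM => // t; apply: cvgB; [exact: cg|exact: cvg_cst].
    - by apply: continuous_funD; apply: continuous_funZ.
    - move=> t; have b0 : 0 <= circle_bump n (dot z (circle_pt t)).
        by apply: circle_bump_ge0; apply: dot_norm_le1 => //; exact: circle_pt_unit.
      rewrite normrM (ger0_norm b0) [C * (_ * _)]mulrA -mulrDl ler_wpM2r//.
      by rewrite distrC; apply: HC => //; exact: circle_pt_unit.
  rewrite circle_meanD; try exact: continuous_funZ.
  rewrite !circle_meanZ// (circle_mean_bump n zv) (circle_mean_bump_spread n zv).
  by rewrite mulr1; move: Cn; move: (C / _) => Z; lra.
pose c j : R := 'C(n, j)%:R / 2 ^+ n / bump_mass n.
have sumc : \sum_(j < n.+1) c j * moment j = 1.
  rewrite -(circle_mean_bump n (@cos_motion R)).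
  under [RHS]eq_circle_mean do rewrite circle_bump_expand.
  rewrite (@circle_mean_sum _ n.+1 (fun j t => c j * cos t ^+ j)).
    apply: eq_bigr => j _; rewrite circle_meanZ; last by apply: continuous_funX;
      exact: continuous_cos.
    by rewrite (moment_circular_motion _ (@cos_motion R)).
  by move=> j; apply: continuous_funZ; apply: continuous_funX; exact: continuous_cos.
have eB : 0 < e / 4 / (B + 1) by rewrite divr_gt0// ltr_wpDl.
have HN := Hpoly c n.+1 _ eB.
near=> N.
have N0 : (0 < N)%N by near: N; exists 1%N.
have N0' : 0 < N%:R :> R by rewrite ltr0n.
have HN1 : forall z, unit_circle z ->
    `|N%:R^-1 * (\sum_(k < N) \sum_(j < n.+1) c j * dot z (a k) ^+ j) -
     \sum_(j < n.+1) c j * moment j| < e / 4 / (B + 1) by near: N.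
have HN2 z : unit_circle z -> `|N%:R^-1 * (\sum_(k < N) circle_bump n (dot z (a
  k))) - 1| < e / 4 / (B + 1).
  move=> /HN1; rewrite sumc.
  by rewrite (eq_bigr (fun k => circle_bump n (dot z (a (nat_of_ord k)))))// =>
    k _; rewrite circle_bump_expand.
have S1 : `|N%:R^-1 * (\sum_(k < N) T (a k)) - circle_mean g| <= e / 4.
  have -> : N%:R^-1 * (\sum_(k < N) T (a k)) - circle_mean g =
     circle_mean (fun t => g t * (N%:R^-1 * (\sum_(k < N) circle_bump n (dot
       (circle_pt t) (a k))) - 1)).
    have cS : continuous (fun t => \sum_(k < N) g t * circle_bump n (dot (a k)
      (circle_pt t))).
      apply: (@continuous_fun_sum _ N (fun k t =>
        g t * circle_bump n (dot (a k) (circle_pt t)))) => k.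
      exact: continuous_funM.
    rewrite [RHS](@eq_circle_mean _ _ (fun t =>
      N%:R^-1 * (\sum_(k < N) g t * circle_bump n (dot (a k) (circle_pt t))) +
        -1 * g t)); last first.
      move=> t; have -> : \sum_(k < N) g t * circle_bump n (dot (a k) (circle_pt t)) =
          g t * \sum_(k < N) circle_bump n (dot (circle_pt t) (a k)).
        by rewrite mulr_sumr; apply: eq_bigr => k _; rewrite dotC.
      by move: (\sum_(k < N) _) (N%:R^-1) => S Q; ring.
    rewrite circle_meanD ?circle_meanZ//; try exact: continuous_funZ.
    rewrite mulN1r; congr (_ * _ - _).
    rewrite (@circle_mean_sum _ N (fun k t => g t * circle_bump n (dot (a k)
      (circle_pt t))))//.
    by move=> k; exact: continuous_funM.
  rewrite -[e / 4]circle_mean_cst; apply: circle_mean_abs_le.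
  - apply: continuous_funM => //.
    have cS : continuous (fun t => \sum_(k < N) circle_bump n (dot (circle_pt t)
      (a k))).
      apply: (@continuous_fun_sum _ N (fun k t =>
        circle_bump n (dot (circle_pt t) (a k)))) => k.
      by rewrite (_ : (fun t => _) = (fun t =>
        circle_bump n (dot (a k) (circle_pt t))))//; apply/funext => t; rewrite dotC.
    have cS2 := @continuous_funZ R (N%:R^-1) _ cS.
    by move=> t; apply: cvgB; [exact: cS2|exact: cvg_cst].
  - exact: cst_continuous.
  - move=> t; rewrite normrM.
    apply: (@le_trans _ _ (B * (e / 4 / (B + 1)))).
      apply: ler_pM => //; first by apply: HB; exact: circle_pt_unit.
      by apply/ltW/HN2; exact: circle_pt_unit.
    rewrite mulrCA ler_piMr ?(ltW e4)// ler_pdivrMr ?ltr_wpDl//; lra.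
have S2 : `|N%:R^-1 * (\sum_(k < N) f (a k)) - N%:R^-1 * (\sum_(k < N) T (a k))|
  <= e / 2.
  rewrite -mulrBr -sumrB normrM gtr0_norm ?invr_gt0// mulrC ler_pdivrMr//.
  apply: le_trans (ler_norm_sum _ _ _) _.
  apply: (@le_trans _ _ (\sum_(k < N) e / 2));
    last by rewrite sumr_const card_ord -(mulr_natr (e / 2)).
  by apply: ler_sum => k _; rewrite distrC; exact: Tf.
rewrite distrC.
set X := N%:R^-1 * _ in S2 *; set Y := N%:R^-1 * _ in S1 S2.
have -> : X - circle_mean (fun t => f (circle_pt t)) =
  (X - Y) + (Y - circle_mean g) by rewrite addrA subrK.
apply: le_lt_trans (ler_normD _ _) _; lra.
Unshelve. all: by end_near. Qed.

End korovkin.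

(** * Empirical measures *)

Section weak_star.
Context {R : realType}.
Local Notation C := (Borel_complex R).
Local Notation S1 := (@unit_circle R : set C).

Lemma empirical_measure_circle (a : nat -> R[i]) N : (forall k, unit_circle (a k)) ->
  (0 < N)%N -> empirical_measure a N S1 = 1%E.
Proof.
move=> ua N0; rewrite /empirical_measure /= /mscale /= /msum.
have H M : (\sum_(k < M) \d_(a k : C) S1)%E = (M%:R)%:E :> \bar R.
  elim: M => [|M ih]; first by rewrite big_ord0.
  rewrite big_ord_recr/= ih diracE mem_set; last exact: ua.
  by rewrite -EFinD natr1.
by rewrite [X in (_ * X)%E]H -EFinM mulVf// pnatr_eq0 -lt0n.
Qed.

Lemma empirical_integral_ge0 (a : nat -> R[i]) N (F : C -> R) :
  (forall k, unit_circle (a k)) ->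
  measurable_fun S1 F -> (forall z, S1 z -> 0 <= F z) ->
  (\int[empirical_measure a N]_(z in S1) (F z)%:E)%E =
    (N%:R^-1 * \sum_(k < N) F (a k))%:E.
Proof.
move=> ua mF F0; have mS := @measurable_unit_circle R.
have mEF : measurable_fun S1 (fun z => (F z)%:E) by exact/measurable_EFinP.
rewrite /empirical_measure ge0_integral_mscale//.
rewrite ge0_integral_measure_sum// EFinM -sumEFin; congr (_ * _)%E.
apply: eq_bigr => k _; rewrite integral_dirac// diracE mem_set ?mul1e//.
Qed.

Lemma empirical_integral (a : nat -> R[i]) N (f : R[i]^o -> R) :
  (forall k, unit_circle (a k)) -> (0 < N)%N ->
  {within @unit_circle R, continuous f} ->
  (\int[empirical_measure a N]_(z in S1) (f z)%:E)%E =
    (N%:R^-1 * \sum_(k < N) f (a k))%:E.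
Proof.
move=> ua N0 cf; have [B B0 HB] := circle_bounded cf.
have mf := within_circle_measurable cf.
have f0 z : S1 z -> 0 <= f z + B.
  by move=> /HB; rewrite ler_norml => /andP[h _]; lra.
rewrite (@integral_shift _ _ _ B (N%:R^-1 * \sum_(k < N) (f (a k) + B))).
- rewrite big_split/= sumr_const card_ord mulrDr -[B *+ N]mulr_natl mulKf ?addrK//.
  by rewrite pnatr_eq0 -lt0n.
- exact: empirical_measure_circle.
- exact/measurable_EFinP.
- by move=> z /f0.
under eq_integral do rewrite -EFinD.
apply: (@empirical_integral_ge0 a N (fun z => f z + B)) => //.
by apply: measurable_funD => //; exact: measurable_cst.
Qed.

Lemma arc_integral (f : R[i]^o -> R) :
  {within @unit_circle R, continuous f} ->
  (\int[@arc_measure R]_(z in S1) (f z)%:E)%E =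
    (circle_mean (fun t => f (circle_pt t)))%:E.
Proof.
move=> cf; have [B B0 HB] := circle_bounded cf.
have mf := within_circle_measurable cf.
have cg := continuous_on_circle cf.
have f0 z : S1 z -> 0 <= f z + B.
  by move=> /HB; rewrite ler_norml => /andP[h _]; lra.
rewrite (@integral_shift _ _ _ B (circle_mean (fun t => f (circle_pt t)) + B)) ?addrK//.
- exact: arc_measure_circle.
- exact/measurable_EFinP.
rewrite arc_integral_ge0//; last by apply: emeasurable_funD;
  [exact/measurable_EFinP|exact: measurable_cst].
rewrite -[X in _ + X](circle_mean_cst B) -circle_meanD//; last exact: cst_continuous.
rewrite -circle_emean_fin//.
by apply: continuous_funD => //; exact: cst_continuous.
Qed.

End weak_star.

(** * Limits of energy and potential, and uniform distribution *)

Theorem theorem1p8 (R : realType) (s : R) (p : nat) (a : nat -> R[i]) :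
  0 <= s -> s < 1 -> (1 <= p)%N -> greedy_energy_sequence s p a ->
  [/\ (fun N => discrete_energy s a N / ((N%:R : R) ^+ 2)%:E)%E @ \oo
        --> arc_energy s,
      (fun N => potential s a N (a N) / (N%:R : R)%:E)%E @ \oo
        --> arc_energy s,
      arc_energy (0 : R) = 0%E
    & weak_star_cvg (empirical_measure a) (arc_measure R)].
Proof.
move=> s0 s1 _ greedy.
have ua := greedy_unit greedy.
rewrite arc_energyE//; split.
- exact: greedy_energy_cvg greedy.
- exact: greedy_potential_cvg greedy.
- by rewrite arc_energyE// riesz_energy0.
- move=> f cf; rewrite arc_integral//.
  have H := uniform_distribution cf ua
    (@poly_average_unif_cvg _ _ _ _ _ _ (riesz_energy_profile s0 s1) ua
      (greedy_dot_lt1 s0 s1 greedy) (greedy_next_potential_le s0 s1 greedy)).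
  have : (N%:R^-1 * \sum_(k < N) f (a k))%:E @[N --> \oo] -->
      (circle_mean (fun t => f (circle_pt t)))%:E.
    by apply: cvg_EFin; [exact: nearW|exact: H].
  apply: cvg_trans; apply: near_eq_cvg; near=> N.
  have N0 : (0 < N)%N by near: N; exists 1%N.
  by rewrite empirical_integral.
Unshelve. all: by end_near. Qed.
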